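(* For $u>0$ and $x\ge 0$ let $$I(u,x)=\bigl(h(u)+pu\bigr)+\limsup_{T\to\infty}\frac1T E\Bigl(\int_0^T C\bigl(X_x^u(t)\bigr)\,dt\Bigr)$$ be the cost functional of the long-run average cost problem. Then: (i) $I(u,x)$ is independent of $x$ and has the representation $I(u):=I(u,x)=h(u)+pu+G(u)$, where $G(u)=E\bigl(C(Z_u)\bigr)$. Furthermore, $I(u)$ is finite for each $u>0$ and is continuous in $u>0$. (ii) $\lim_{u\to0^+}I(u)=+\infty$ and $\lim_{u\to\infty}I(u)=+\infty$. (iii) If $h$ and $C$ are convex functions, then $I$ is also convex.
   Context: Let $H\in[\tfrac12,1)$ and let $W_H=(W_H(t))_{t\ge 0}$ be a fractional Brownian motion with Hurst parameter $H$: a continuous zero-mean Gaussian process with $W_H(0)=0$ and $\mathrm{Cov}(W_H(s),W_H(t))=\frac12\bigl[t^{2H}+s^{2H}-|t-s|^{2H}\bigr]$ for $s,t\ge 0$. For $x\ge 0$ and $u\ge 0$ define, for $t\ge 0$, $$L_x^u(t)=-\min\Bigl\{0,\min_{s\in[0,t]}\bigl(x-us+W_H(s)\bigr)\Bigr\},\qquad X_x^u(t)=x-ut+W_H(t)+L_x^u(t).$$ For $u>0$ put $Z_u=\max_{s\ge 0}\{W_H(s)-us\}$ (almost surely finite). Standing assumptions: $p\ge 0$ is a constant; $h:[0,\infty)\to[0,\infty)$ is continuous, non-decreasing, with $\lim_{u\to\infty}h(u)=+\infty$; $C:[0,\infty)\to[0,\infty)$ is continuous, non-decreasing, and satisfies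 $C(y)\le K(1+y^\gamma)$ for all $y\ge0$, for some constants $K>0$, $\gamma>0$.
   Formalization: The limit of I(u) as u→0+ is stated only when C(y)→+∞ as y→∞; without this it is false, e.g. for C=0, where I(u)=h(u)+pu→h(0), and it fails for every bounded C. *)

(* Defs.v *)
From HB Require Import structures.
From mathcomp Require Import all_boot all_order all_algebra.
From mathcomp Require Import all_classical all_reals all_analysis.

Set Implicit Arguments.
Unset Strict Implicit.
Unset Printing Implicit Defensive.

Import Order.TTheory GRing.Theory Num.Theory.
Import numFieldNormedType.Exports.

Local Open Scope classical_set_scope.
Local Open Scope ring_scope.

(** Processes are indexed by all of [R], but only the times [t >= 0] matter:
    every condition and every functional below looks at those times only. *)

(** [normal_prob m 0] is by convention the uniform law on [0, 1], so the
    degenerate Gaussian law has to be given separately as a Dirac mass. *)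
Definition gaussian_law (R : realType) (m s : R) (A : set R) : \bar R :=
  if s == 0 then \d_m A else normal_prob m s A.

Definition is_gaussian_process (d : measure_display) (Omega : measurableType d)
    (R : realType) (P : probability Omega R) (W : R -> {RV P >-> R}) : Prop :=
  forall (n : nat) (t a : 'I_n -> R), (forall i, 0 <= t i) ->
  exists m s : R, forall A : set R, measurable A ->
    P [set w | A (\sum_(i < n) a i * W (t i) w)] = gaussian_law m s A.

Arguments is_gaussian_process {d Omega R} P W.

Definition is_fBm (d : measure_display) (Omega : measurableType d)
    (R : realType) (P : probability Omega R) (H : R)
    (W : R -> {RV P >-> R}) : Prop :=
  [/\ forall w, {within `[0, +oo[, continuous (fun t => W t w)},
      is_gaussian_process P W,
      forall t, 0 <= t -> ('E_P[W t] = 0)%E,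
      forall w, W 0 w = 0
    & forall s t, 0 <= s -> 0 <= t ->
        covariance P (W s) (W t) =
        (2^-1 * (t `^ (2 * H) + s `^ (2 * H) - `|t - s| `^ (2 * H)))%:E].

Arguments is_fBm {d Omega R} P H W.

(** For a continuous path [w] the infimum over [[0, t]] is a minimum. *)
Definition regulator (R : realType) (x u : R) (w : R -> R) (t : R) : R :=
  - Num.min 0 (inf [set x - u * s + w s | s in `[0, t]]).

Definition reflected (R : realType) (x u : R) (w : R -> R) (t : R) : R :=
  x - u * t + w t + regulator x u w t.

Definition max_workload (R : realType) (u : R) (w : R -> R) : \bar R :=
  ereal_sup [set (w s - u * s)%:E | s in `[0, +oo[].

Section Cost.
Context (d : measure_display) (Omega : measurableType d) (R : realType).
Context (P : probability Omega R) (W : R -> {RV P >-> R}).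
Local Open Scope ereal_scope.

Definition average_cost (p : R) (h C : R -> R) (u x : R) : \bar R :=
  (h u + p * u)%:E +
  limf_esup (fun T : R => (T^-1)%:E *
      'E_P[fun w => (\int[lebesgue_measure]_(t in `[0%R, T])
                        C (reflected x u (fun s => W s w) t))%R])
    (+oo_R)%R.

(** [max_workload] is almost surely finite when [0 < u], so [fine] changes it
    on a null set only. *)
Definition stationary_cost (C : R -> R) (u : R) : \bar R :=
  'E_P[fun w => C (fine (max_workload u (fun s => W s w)))].

End Cost.

Arguments average_cost {d Omega R} P W p h C u x.
Arguments stationary_cost {d Omega R} P W C u.

(* Main.v *)
Require Import Defs.
From HB Require Import structures.
From mathcomp Require Import all_boot all_order all_algebra.
From mathcomp Require Import all_classical all_reals all_analysis.
From mathcomp Require Import measurable_realfun zify ring lra.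

Set Implicit Arguments.
Unset Strict Implicit.
Unset Printing Implicit Defensive.

Import Order.TTheory GRing.Theory Num.Theory.
Import numFieldNormedType.Exports.

Local Open Scope classical_set_scope.
Local Open Scope ring_scope.

(** The idea is to reverse time. The reflection map gives the content at time
    [t] as the larger of [x - u t + W t] and the maximum over [s <= t] of
    [W t - W s - u (t - s)]. Since [s |-> W t - W (t - s)] has on [[0, t]] the
    law of [W], the content at time [t] has the same law as
    [forward_content x u t], the larger of [x - u t + W t] and the maximum over
    [s <= t] of [W s - u s] ([reflected_forward_law]). As [t] grows, the first
    of these two terms goes to minus infinity, whatever the initial content
    [x], and the second one increases to the maximal workload [Z_u]. The
    function is at most [x + Z_u] throughout, and [C (x + Z_u)] is integrable
    because [C] grows polynomially ([integrable_cost]); dominated convergence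
    gives [E (C (X t)) --> E (C Z_u)] ([cvg_mean_cost]). Tonelli's theorem and
    the convergence of Cesaro means then give the long-run average
    ([average_costE]).

    Two properties of fractional Brownian motion carry this argument.
    - Time reversal in law. The covariance gives the law of every finite linear
      combination of the values of the path; to reach events about a whole path,
      this has to determine joint laws (Cramer and Wold). Here the joint law is
      obtained as the probability of the orthants, whose indicators are bounded
      pointwise limits of polynomials in sines of linear forms
      ([orthant_prob_eq]).
    - Moments. All powers of [Z_u] are integrable. By chaining, the oscillation
      of the path over [[n, n + 1]] is controlled by an even power sum of its
      dyadic increments, whose expectation is bounded uniformly in [n]; reaching
      the level [u n] at a time in this interval is then so costly in moments
      of high order that the bounds can be added over [n]
      ([fbm_domination]). The restriction on [H] enters twice: increments over
      short intervals are at most of Brownian size because [1/2 <= H], and [W]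
      grows more slowly than [u t] because [H < 1].

    The other claims are about [Z_u] as a function of [u] for a fixed path. It
    is a supremum of nonincreasing affine functions of [u], hence nonincreasing,
    convex ([fine_workload_convex]) and, where finite, continuous
    ([fine_workload_continuous]); integration transfers this to
    [E (C Z_u)]. When [u] goes to [0], [Z_u >= W s - u s] for a fixed large [s],
    and [W s] is a centred Gaussian variable of large variance, so that [Z_u]
    exceeds any given level with probability at least [1/4]
    ([stationary_cost_cvg0]). At infinity, the term [h u] suffices. *)

(** * The normal law *)
Section normal_integral.
Context {R : realType}.
Local Notation mu := (@lebesgue_measure R).
Local Notation N01 := (@normal_prob R 0 1).

Lemma ge0_integral_normal_prob (m s : R) (g : R -> R) :
  measurable_fun [set: R] g -> (forall x, 0 <= g x) ->
  (\int[normal_prob m s]_x (g x)%:E =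
   \int[mu]_x (g x * normal_pdf m s x)%:E)%E.
Proof.
move=> mg g0.
have dom : normal_prob m s `<< mu by exact: normal_prob_dominates.
rewrite -(Radon_Nikodym_SigmaFinite.change_of_variables dom)//; last exact/measurable_EFinP.
apply: ae_eq_integral => //.
- apply: emeasurable_funM; first exact/measurable_EFinP.
  exact: measurable_int (Radon_Nikodym_SigmaFinite.f_integrable dom).
- apply/measurable_EFinP; apply: measurable_funM => //.
  exact: measurable_normal_pdf.
under [X in ae_eq _ _ _ X]eq_fun do rewrite EFinM.
apply: ae_eqe_mul2l.
apply: integral_ae_eq => //.
- exact: Radon_Nikodym_SigmaFinite.f_integrable.
- by apply/measurable_EFinP; exact: measurable_normal_pdf.
- by move=> E ET mE; rewrite -Radon_Nikodym_SigmaFinite.f_integral.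
Qed.

(** Substitution of [m + `|s| * y]: the density depends on [s] through [s ^+ 2]. *)
Lemma ge0_integral_normal_std (m s : R) (g : R -> R) : s != 0 ->
  continuous g -> (forall x, 0 <= g x) ->
  (\int[normal_prob m s]_x (g x)%:E = \int[N01]_x (g (m + `|s| * x))%:E)%E.
Proof.
move=> s0 cg g0.
have mg : measurable_fun [set: R] g by exact: continuous_measurable_fun.
have s_gt0 : 0 < `|s| by rewrite normr_gt0.
have cF : continuous (fun x => m + `|s| * x).
  move=> x; apply: cvgD; first exact: cvg_cst.
  by apply: cvgM; [exact: cvg_cst|exact: cvg_id].
rewrite (ge0_integral_normal_prob m s mg g0).
rewrite (@ge0_integral_normal_prob 0 1 (fun x => g (m + `|s| * x))); first last.
- by move=> x; exact: g0.
- by apply: measurableT_comp => //; exact: continuous_measurable_fun.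
have F'E : derive1 (fun x : R => m + `|s| * x) = cst `|s|.
  apply/funext => x; rewrite derive1E deriveD// derive_cst add0r.
  by rewrite deriveZ//= derive_id; rewrite /GRing.scale/= mulr1.
rewrite (@increasing_ge0_integration_by_substitutionT _
  (fun x => m + `|s| * x)); last first.
- by move=> x; rewrite mulr_ge0// normal_pdf_ge0.
- move=> x; apply: cvgM; first exact: cg.
  exact: continuous_normal_pdf.
- apply: cvg_comp; last exact: cvg_addrl.
  exact/gt0_cvgMry.
- apply: cvg_comp; last exact: cvg_addrl_Ny.
  exact/gt0_cvgMrNy.
- by move=> x; apply: derivableD => //; apply: derivableZ.
- by rewrite F'E; exact: is_cvg_cst.
- by rewrite F'E; exact: is_cvg_cst.
- by rewrite F'E; exact: cst_continuous.
- by move=> x y xy; rewrite ltrD2l ltr_pM2l.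
apply: eq_integral => x _; congr EFin; rewrite F'E !fctE/= -mulrA; congr (_ * _).
rewrite !normal_pdfE ?oner_eq0// /normal_fun /normal_peak.
rewrite addrAC subrr add0r subr0 exprMn -normrX ger0_norm ?sqr_ge0//.
rewrite mulrAC; congr (_ * expR _).
  rewrite -mulrnAr -[in RHS]mulrnAr !(sqrtrM _ (sqr_ge0 _)).
  rewrite sqrtr_sqr expr1n sqrtr1 mul1r invfM mulrAC mulVf ?mul1r//.
  by rewrite gt_eqF.
rewrite expr1n -mulr_natr -[in RHS]mulr_natr; field.
by rewrite ?s0.
Qed.

Lemma ge0_integral_normalN (g : R -> R) :
  measurable_fun [set: R] g -> (forall x, 0 <= g x) ->
  (\int[N01]_x (g (- x))%:E = \int[N01]_x (g x)%:E)%E.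
Proof.
move=> mg g0.
have mgN : measurable_fun [set: R] (fun x => g (- x)).
  by apply: measurableT_comp => //; exact: oppr_measurable.
rewrite (ge0_integral_normal_prob 0 1 mg g0).
rewrite (@ge0_integral_normal_prob 0 1 (fun x => g (- x)))//.
have pdfN x : normal_pdf 0 1 (- x) = normal_pdf 0 1 x :> R.
  by rewrite !normal_pdfE ?oner_eq0// /normal_fun /= !subr0 sqrrN.
pose f x := (g x * normal_pdf 0 1 x)%:E.
transitivity (\int[pushforward mu (-%R : _ -> measurableTypeR R)]_x f x)%E.
  rewrite ge0_integral_pushforward; [|by []|by []| |].
  - by apply: eq_integral => x _; rewrite /f /= pdfN.
  - apply/measurable_EFinP; apply: measurable_funM => //.
    exact: measurable_normal_pdf.
  - by move=> x _; rewrite lee_fin mulr_ge0// normal_pdf_ge0.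
by apply: eq_measure_integral => A mA _; exact: lebesgue_measureN.
Qed.

(** Up to a constant, [x ^+ (2 * q)] times the standard density is below the
    density of standard deviation [2]: the power is absorbed by part of the
    Gaussian exponent. *)
Lemma normal_moment_lty (q : nat) : (\int[N01]_x (x ^+ (2 * q))%:E < +oo)%E.
Proof.
have mX : measurable_fun [set: R] (fun x : R => x ^+ (2 * q)).
  exact: exprn_measurable.
have X0 (x : R) : 0 <= x ^+ (2 * q) by rewrite exprM exprn_ge0// sqr_ge0.
rewrite (ge0_integral_normal_prob 0 1 mX X0).
pose s : R := 2.
have s0 : s != 0 by rewrite /s pnatr_eq0.
pose c : R := (4 ^+ q * q`!%:R) * (normal_peak 1 / normal_peak s).
have c0 : 0 <= c.
  by rewrite /c !mulr_ge0 ?invr_ge0 ?normal_peak_ge0// exprn_ge0.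
apply: (@le_lt_trans _ _ (\int[mu]_x (c * normal_pdf 0 s x)%:E)%E); last first.
  under eq_integral do rewrite EFinM.
  by rewrite integralZl//= ?integral_normal_pdf ?mule1 ?ltry//;
    exact: integrable_normal_pdf.
apply: ge0_le_integral => //.
- by move=> x _; rewrite lee_fin mulr_ge0// normal_pdf_ge0.
- apply/measurable_EFinP; apply: measurable_funM => //.
  exact: measurable_normal_pdf.
- apply/measurable_EFinP; apply: measurable_funM => //.
  exact: measurable_normal_pdf.
move=> x _; rewrite lee_fin !normal_pdfE ?oner_eq0//.
rewrite /c /=.
set a := normal_peak 1; set b := normal_peak s.
have b0 : b != 0 by rewrite gt_eqF// normal_peak_gt0.
rewrite (_ : _ * (a / b) * (b * _) = a * (4 ^+ q * q`!%:R * normal_fun 0 s x));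
  last by field.
rewrite mulrCA ler_wpM2l ?normal_peak_ge0//.
have -> : normal_fun 0 s x = expR (x ^+ 2 * (3 / 8)) * normal_fun 0 1 x.
  rewrite /normal_fun -expRD; congr expR; by rewrite /s !subr0; field.
rewrite mulrA ler_wpM2r ?normal_fun_ge0//.
rewrite exprM.
have y0 : 0 <= x ^+ 2 / 4 by rewrite divr_ge0// sqr_ge0.
have h : (x ^+ 2 / 4) ^+ q / q`!%:R <= expR (x ^+ 2 * (3 / 8)).
  apply: (@le_trans _ _ (expR (x ^+ 2 / 4))).
    case: q {mX X0 c c0} => [|n]; first by rewrite expr0 fact0 divr1 -[leLHS]expR0 ler_expR.
    by apply: le_trans (expR_ge1Dxn n y0); rewrite lerDr.
  rewrite ler_expR ler_wpM2l ?sqr_ge0//; lra.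
apply: le_trans (ler_wpM2l _ h); last by rewrite mulr_ge0// exprn_ge0.
rewrite [(x ^+ 2 / 4) ^+ q]expr_div_n le_eqVlt; apply/orP; left; apply/eqP.
field.
by rewrite expf_neq0 ?pnatr_eq0// -lt0n fact_gt0.
Qed.

Lemma normal_prob_setT : N01 [set: measurableTypeR R] = 1%E.
Proof. exact: (@probability_setT _ _ _ (N01 : probability (measurableTypeR R) R)). Qed.

Lemma integral_cst_normal (c : R) : (\int[N01]_x c%:E = c%:E)%E.
Proof. by rewrite integral_cst// [X in (_ * X)%E]normal_prob_setT mule1. Qed.

(** Otherwise the law would be concentrated at [0], which is a null set. *)
Lemma normal_second_moment_gt0 : (0 < \int[N01]_x (x ^+ 2)%:E)%E.
Proof.
have mX : measurable_fun [set: R] (fun x : R => x ^+ 2) by exact: exprn_measurable.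
rewrite lt_neqAle eq_sym; apply/andP; split; last first.
  by apply: integral_ge0 => x _; rewrite lee_fin sqr_ge0.
apply/eqP => i0.
have : (\int[N01]_(x in setT) `|(x ^+ 2)%:E| = 0)%E.
  rewrite -[RHS]i0; apply: eq_integral => x _.
  by rewrite gee0_abs// lee_fin sqr_ge0.
move/(@ae_eq_integral_abs _ _ _ N01 setT measurableT (fun x => (x ^+ 2)%:E)).
move=> /(_ _)[]; first exact/measurable_EFinP.
move=> A [mA A0 sA].
have : (N01 (~` [set 0%R : R]) <= 0)%E.
  rewrite -A0; apply: le_measure; rewrite ?inE//; first exact: measurableC.
  apply: subset_trans sA => x /= x0 /(_ Logic.I) [] /eqP.
  by rewrite sqrf_eq0 => /eqP.
rewrite probability_setC; last by [].
have N0 : N01 [set 0%R : R] = 0%E.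
  have /null_content_dominatesP := normal_prob_dominates 0 1 (R := R).
  by move=> h; apply: h; [exact: measurable_set1|exact: lebesgue_measure_set1].
by rewrite [X in (1 - X)%E]N0 sube0 lee_fin ler10.
Qed.

Lemma normal_mean0 : (\int[N01]_x x%:E = 0)%E.
Proof.
have mid : measurable_fun [set: R] (@id R) by exact: measurable_id.
rewrite integralE.
have E1 : (\int[N01]_x ((fun x : R => x%:E)^\+ x) = \int[N01]_x (Num.max x 0)%:E)%E.
  by apply: eq_integral => x _; rewrite unlock EFin_max.
have E2 : (\int[N01]_x ((fun x : R => x%:E)^\- x) = \int[N01]_x (Num.max (- x) 0)%:E)%E.
  by apply: eq_integral => x _; rewrite unlock EFin_max EFinN.
rewrite E1 E2 (@ge0_integral_normalN (fun x => Num.max x 0)); last 2 first.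
- exact: measurable_maxr.
- by move=> x; rewrite le_max lexx orbT.
rewrite subee// ge0_fin_numE; last first.
  by apply: integral_ge0 => x _; rewrite lee_fin le_max lexx orbT.
apply: (@le_lt_trans _ _ (\int[N01]_x (1 + x ^+ (2 * 1))%:E)%E).
  apply: ge0_le_integral => //.
  - by move=> x _; rewrite lee_fin le_max lexx orbT.
  - exact/measurable_EFinP/measurable_maxr.
  - apply/measurable_EFinP/measurable_funD => //; exact: exprn_measurable.
  - move=> x _; rewrite lee_fin muln1 ge_max; apply/andP; split.
      by have := sqr_ge0 (x - 2^-1); rewrite sqrrB; lra.
    by rewrite addr_ge0// sqr_ge0.
under eq_integral do rewrite EFinD.
rewrite ge0_integralD//.
- by rewrite integral_cst_normal lte_add_pinfty ?ltry// normal_moment_lty.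
- by move=> x _; rewrite lee_fin exprM exprn_ge0// sqr_ge0.
- by apply/measurable_EFinP; exact: exprn_measurable.
Qed.

End normal_integral.

(** The even moments of the standard normal law; only their finiteness and the
    positivity of the second one matter, so they are left uncomputed. *)
Definition normal_moment (R : realType) (q : nat) : R :=
  fine (\int[@normal_prob R 0 1]_x (x ^+ (2 * q))%:E)%E.

Section normal_moment.
Context {R : realType}.
Local Notation N01 := (@normal_prob R 0 1).

Lemma normal_momentE q :
  (normal_moment R q)%:E = (\int[N01]_x (x ^+ (2 * q))%:E)%E.
Proof.
rewrite fineK// ge0_fin_numE ?normal_moment_lty//.
by apply: integral_ge0 => x _; rewrite lee_fin exprM exprn_ge0// sqr_ge0.
Qed.

Lemma normal_moment_ge0 q : 0 <= normal_moment R q.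
Proof.
apply: fine_ge0; apply: integral_ge0 => x _.
by rewrite lee_fin exprM exprn_ge0// sqr_ge0.
Qed.

Lemma normal_moment1_gt0 : 0 < normal_moment R 1.
Proof. by rewrite -lte_fin normal_momentE muln1 normal_second_moment_gt0. Qed.

End normal_moment.

(** * Centred Gaussian variables *)

(** The mean and the second moment are those of [X] itself rather than the
    parameters of the law: that is how the covariance of a process gives them. *)
Definition centred_gaussian d (T : measurableType d) (R : realType)
    (P : probability T R) (X : T -> R) (v : R) : Prop :=
  [/\ measurable_fun setT X,
      exists m s, forall A : set R, measurable A ->
        P [set w | A (X w)] = gaussian_law m s A,
      (\int[P]_w (X w)%:E = 0)%E & (\int[P]_w ((X w) ^+ 2)%:E = v%:E)%E].

Section centred_gaussian.
Context d (T : measurableType d) (R : realType) (P : probability T R).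
Local Notation N01 := (@normal_prob R 0 1).
Implicit Types (X Y : T -> R) (g : R -> R).

Lemma ge0_integral_gaussian_law X m s g : measurable_fun setT X ->
  (forall A : set R, measurable A -> P [set w | A (X w)] = gaussian_law m s A) ->
  continuous g -> (forall x, 0 <= g x) ->
  (\int[P]_w (g (X w))%:E = \int[N01]_x (g (m + `|s| * x))%:E)%E.
Proof.
move=> mX lawX cg g0.
have mg : measurable_fun [set: R] g by exact: continuous_measurable_fun.
have mgE : measurable_fun [set: measurableTypeR R] (EFin \o g).
  exact/measurable_EFinP.
transitivity (\int[pushforward P (X : T -> measurableTypeR R)]_x (g x)%:E)%E.
  rewrite ge0_integral_pushforward; [by []|by []|by []|exact: mgE|].
  by move=> x _; rewrite lee_fin.
have [s0|s0] := eqVneq s 0.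
  rewrite s0 normr0; under [RHS]eq_integral do rewrite mul0r addr0.
  rewrite integral_cst_normal.
  rewrite (@eq_measure_integral _ _ _ setT (@dirac _ (measurableTypeR R) m R) _).
    by rewrite integral_dirac// diracT mul1e.
  move=> A mA _; rewrite /pushforward.
  by rewrite [LHS](lawX A mA) /gaussian_law s0 eqxx.
rewrite -ge0_integral_normal_std//.
apply: eq_measure_integral => A mA _; rewrite /pushforward.
by rewrite [LHS](lawX A mA) /gaussian_law (negbTE s0).
Qed.

Lemma gaussian_law_mean X m s : measurable_fun setT X ->
  (forall A : set R, measurable A -> P [set w | A (X w)] = gaussian_law m s A) ->
  (\int[P]_w (X w)%:E = m%:E)%E.
Proof.
move=> mX lawX.
have cmax : continuous (fun x : R => Num.max x 0).
  by move=> x; apply: continuous_max; [exact: cvg_id|exact: cvg_cst].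
have cmaxN : continuous (fun x : R => Num.max (- x) 0).
  move=> x; apply: continuous_max; last exact: cvg_cst.
  by apply: cvgN; exact: cvg_id.
transitivity (\int[N01]_x (m + `|s| * x)%:E)%E.
  rewrite integralE [RHS]integralE.
  congr (_ - _)%E.
  - transitivity (\int[P]_w (Num.max (X w) 0)%:E)%E.
      by apply: eq_integral => w _; rewrite unlock EFin_max.
    rewrite (@ge0_integral_gaussian_law X m s (fun x => Num.max x 0))//.
    + by apply: eq_integral => w _; rewrite unlock EFin_max.
    + by move=> x; rewrite le_max lexx orbT.
  - transitivity (\int[P]_w (Num.max (- X w) 0)%:E)%E.
      by apply: eq_integral => w _; rewrite unlock EFin_max EFinN.
    rewrite (@ge0_integral_gaussian_law X m s (fun x => Num.max (- x) 0))//.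
    + by apply: eq_integral => w _; rewrite unlock EFin_max EFinN.
    + by move=> x; rewrite le_max lexx orbT.
have iX : N01.-integrable setT (EFin \o (@id R)).
  apply/integrableP; split; first exact/measurable_EFinP.
  apply: (@le_lt_trans _ _ (\int[N01]_x (1 + x ^+ (2 * 1))%:E)%E).
    apply: ge0_le_integral => //.
    - by apply/measurable_EFinP; exact: measurableT_comp.
    - apply/measurable_EFinP/measurable_funD => //; exact: exprn_measurable.
    - move=> x _; rewrite lee_fin muln1.
      have := sqr_ge0 (`|x| - 2^-1); rewrite sqrrB real_normK ?num_real//; lra.
  under eq_integral do rewrite EFinD.
  rewrite ge0_integralD//.
  - by rewrite integral_cst_normal lte_add_pinfty ?ltry// normal_moment_lty.
  - by move=> x _; rewrite lee_fin exprM exprn_ge0// sqr_ge0.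
  - by apply/measurable_EFinP; exact: exprn_measurable.
under eq_integral do rewrite EFinD EFinM.
rewrite integralD//; last 2 first.
- exact: finite_measure_integrable_cst.
- exact: integrableZl.
rewrite integral_cst_normal integralZl//.
by rewrite normal_mean0 mule0 adde0.
Qed.

(** The mean forces [m = 0] and the second moment determines [s] up to its sign,
    also in the degenerate case [s = 0]. *)
Lemma centred_gaussian_law X v : centred_gaussian P X v ->
  exists2 s, 0 <= s & s ^+ 2 * normal_moment R 1 = v /\
    forall A : set R, measurable A -> P [set w | A (X w)] = gaussian_law 0 s A.
Proof.
move=> [mX [m [s lawX]] meanX varX].
have m0 : m = 0.
  by apply: EFin_inj; rewrite -(gaussian_law_mean mX lawX).
exists `|s| => //; split.
  apply: EFin_inj; rewrite -varX.
  rewrite (@ge0_integral_gaussian_law X m s (fun x => x ^+ 2))//.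
  - rewrite m0; under [RHS]eq_integral do rewrite add0r exprMn EFinM.
    rewrite ge0_integralZl//.
    + by rewrite EFinM normal_momentE muln1.
    + by apply/measurable_EFinP; exact: exprn_measurable.
    + by move=> x _; rewrite lee_fin sqr_ge0.
  - exact: exprn_continuous.
  - by move=> x; rewrite sqr_ge0.
move=> A mA; rewrite (lawX _ mA) m0 /gaussian_law normr_eq0.
case: ifPn => [//|s0].
apply: eq_integral => x _; rewrite !normal_pdfE ?normr_eq0//.
by rewrite /normal_peak /normal_fun real_normK ?num_real.
Qed.

(** The standard second moment is positive, so that the variance determines the
    scale. *)
Lemma centred_gaussian_unique X Y v : centred_gaussian P X v ->
  centred_gaussian P Y v ->
  forall A : set R, measurable A -> P [set w | A (X w)] = P [set w | A (Y w)].
Proof.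
move=> /centred_gaussian_law[s s0 [sv lawX]] /centred_gaussian_law[t t0 [tv lawY]].
move=> A mA; rewrite (lawX _ mA) (lawY _ mA); congr gaussian_law.
apply/eqP; rewrite -(@eqrXn2 _ 2)//; apply/eqP.
by apply: (mulIf (lt0r_neq0 (@normal_moment1_gt0 R))); rewrite sv tv.
Qed.

Lemma centred_gaussian_moment X v q : centred_gaussian P X v ->
  (\int[P]_w ((X w) ^+ (2 * q))%:E =
   (normal_moment R q / normal_moment R 1 ^+ q * v ^+ q)%:E)%E.
Proof.
move=> gX; have [s s0 [sv lawX]] := centred_gaussian_law gX.
have [mX _ _ _] := gX.
rewrite (@ge0_integral_gaussian_law X 0 s (fun x => x ^+ (2 * q)))//.
- under eq_integral do rewrite add0r exprMn EFinM.
  rewrite ge0_integralZl//.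
  + rewrite -normal_momentE -EFinM -sv; congr EFin.
    rewrite exprM real_normK ?num_real// exprMn mulrC -mulrA.
    congr (_ * _); rewrite !exprMn mulrCA mulVf ?mulr1 -?exprD ?addnn ?mul2n//.
    by rewrite gt_eqF// exprn_gt0// normal_moment1_gt0.
  + by apply/measurable_EFinP; exact: exprn_measurable.
  + by move=> x _; rewrite lee_fin exprM exprn_ge0// sqr_ge0.
- exact: exprn_continuous.
- by move=> x; rewrite exprM exprn_ge0// sqr_ge0.
Qed.

(** The hypothesis says that the standard deviation exceeds [4 * c]. The density is
    at most its inverse, and the ball has length [2 * c]. *)
Lemma gaussian_small_ball X (v c : R) : centred_gaussian P X v -> 0 <= c ->
  16 * c ^+ 2 * normal_moment R 1 < v -> (P [set w | (`|X w| <= c)%R] <= (2^-1)%:E)%E.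
Proof.
move=> /centred_gaussian_law[s s0 [sv lawX]] c0 cv.
have s_gt : 4 * c < s.
  rewrite -(@ltr_pXn2r _ 2)// ?nnegrE ?mulr_ge0//.
  rewrite -sv in cv; rewrite ltr_pM2r in cv; last exact: normal_moment1_gt0.
  by rewrite exprMn; lra.
have s_gt0 : 0 < s by apply: le_lt_trans s_gt; rewrite mulr_ge0.
have -> : [set w | (`|X w| <= c)%R] = [set w | `[- c, c]%classic (X w)].
  by apply/seteqP; split => w /=; rewrite in_itv/= -ler_norml.
rewrite (lawX _ (measurable_itv _)) /gaussian_law gt_eqF//.
rewrite /normal_prob.
apply: (@le_trans _ _ (\int[lebesgue_measure]_(x in `[(- c)%R, c]) (normal_peak s)%:E)%E).
  apply: ge0_le_integral => //.
  - by move=> x _; rewrite lee_fin normal_pdf_ge0.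
  - by apply/measurable_EFinP; apply: measurable_funTS; exact: measurable_normal_pdf.
  - by move=> x _; rewrite lee_fin normal_pdf_ub// gt_eqF.
rewrite integral_cst//= lebesgue_measure_itv/= lte_fin.
case: ifPn => [cc|_]; last by rewrite mule0 lee_fin invr_ge0.
rewrite -EFinD -EFinM lee_fin opprK.
have : normal_peak s <= s^-1.
  rewrite /normal_peak lef_pV2 ?posrE//; last first.
    by rewrite sqrtr_gt0 pmulrn_lgt0// mulr_gt0 ?exprn_gt0 ?pi_gt0.
  rewrite -[leLHS]gtr0_norm// -sqrtr_sqr ler_wsqrtr// -mulrnAr ler_peMr ?sqr_ge0//.
  by have := pi_ge2 R; rewrite mulr2n; lra.
have c0' : 0 <= c + c by lra.
move=> /(ler_wpM2r c0') /le_trans; apply.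
by rewrite mulrC ler_pdivrMr//; lra.
Qed.

End centred_gaussian.

(** The small ball has at most half of the mass, and by symmetry each side of it
    has half of the rest. *)
Lemma gaussian_tail d (T : measurableType d) (R : realType) (P : probability T R)
    (X : T -> R) (v c : R) : 0 <= c ->
  centred_gaussian P X v -> centred_gaussian P (fun w => - X w) v ->
  16 * c ^+ 2 * normal_moment R 1 < v -> ((4^-1)%:E <= P [set w | (c < X w)%R])%E.
Proof.
move=> c0 gX gN cv; have [mX _ _ _] := gX; have [mN _ _ _] := gN.
pose A := [set w | c < X w]; pose B := [set w | c < - X w].
pose D := [set w | `|X w| <= c].
have mA : measurable A.
  by rewrite -[X in measurable X]setTI; exact: measurable_fun_ltr.
have mB : measurable B.
  by rewrite -[X in measurable X]setTI; exact: measurable_fun_ltr.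
have mD : measurable D.
  by rewrite -[X in measurable X]setTI; apply: measurable_fun_ler => //; exact: measurableT_comp.
have AB : P A = P B.
  have := centred_gaussian_unique gX gN (measurable_itv `]c, +oo[).
  by congr (P _ = P _); apply/seteqP; split => w /=; rewrite in_itv/= andbT.
have PD : (P D <= (2^-1)%:E)%E by exact: gaussian_small_ball gX c0 cv.
have cover : (1 <= P D + (P A + P B))%E.
  rewrite -(probability_setT P).
  apply: (@le_trans _ _ (P (D `|` (A `|` B)))).
    apply: le_measure; rewrite ?inE//; first by apply: measurableU => //; exact: measurableU.
    move=> w _ /=; have [h|h] := leP `|X w| c; first by left.
    by right; move: h; rewrite lter_normr => /orP[]; [left|right].
  have mAB : measurable (A `|` B) by exact: measurableU.
  apply: (@le_trans _ _ (P D + P (A `|` B))%E); first exact: measureU2.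
  by apply: leeD => //; exact: measureU2.
rewrite -AB in cover.
have fA : P A \is a fin_num by exact: fin_num_measure.
have fD : P D \is a fin_num by exact: fin_num_measure.
move: cover PD; rewrite -/A -(fineK fA) -(fineK fD) -!EFinD !lee_fin => h1 h2; lra.
Qed.

(** * Linear combinations of fractional Brownian motion *)

Section square_integrable.
Context d (T : measurableType d) (R : realType) (P : probability T R).
Implicit Types (X Y : T -> R).

Lemma integrable_mul_sqr X Y :
  measurable_fun setT X -> measurable_fun setT Y ->
  P.-integrable setT (fun w => (X w ^+ 2)%:E) ->
  P.-integrable setT (fun w => (Y w ^+ 2)%:E) ->
  P.-integrable setT (fun w => (X w * Y w)%:E).
Proof.
move=> mX mY iX iY.
apply: (@le_integrable _ _ _ P setT measurableT _
    (fun w => ((X w ^+ 2)%:E + (Y w ^+ 2)%:E)%E)).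
- by apply/measurable_EFinP; exact: measurable_funM.
- move=> w _; rewrite -EFinD !abse_EFin lee_fin normrM.
  rewrite [leRHS]ger0_norm ?addr_ge0 ?sqr_ge0//.
  rewrite -(real_normK (num_real (X w))) -(real_normK (num_real (Y w))).
  have := sqr_ge0 (`|X w| - `|Y w|); have := mulr_ge0 (normr_ge0 (X w)) (normr_ge0 (Y w)).
  rewrite sqrrB; lra.
- exact: integrableD.
Qed.

Lemma integrable_of_sqr X : measurable_fun setT X ->
  P.-integrable setT (fun w => (X w ^+ 2)%:E) ->
  P.-integrable setT (EFin \o X).
Proof.
move=> mX iX.
have -> : EFin \o X = (fun w => (X w * cst 1 w)%:E).
  by apply/funext => w; rewrite /= mulr1.
apply: integrable_mul_sqr => //.
under eq_fun do rewrite expr1n.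
exact: finite_measure_integrable_cst.
Qed.

Lemma integral_sqr_lincomb n (X : 'I_n -> T -> R) (b : 'I_n -> R)
    (c : 'I_n -> 'I_n -> R) :
  (forall i j, P.-integrable setT (fun w => (X i w * X j w)%:E)) ->
  (forall i j, \int[P]_w (X i w * X j w)%:E = (c i j)%:E)%E ->
  (\int[P]_w ((\sum_(i < n) b i * X i w) ^+ 2)%:E =
   (\sum_(i < n) \sum_(j < n) b i * b j * c i j)%:E)%E.
Proof.
move=> iX cX.
transitivity (\int[P]_w (\sum_(i < n) \sum_(j < n)
    (b i * b j)%:E * (X i w * X j w)%:E))%E.
  apply: eq_integral => w _; rewrite expr2 big_distrlr/= -sumEFin.
  apply: eq_bigr => i _; rewrite -sumEFin; apply: eq_bigr => j _.
  by rewrite -EFinM; congr EFin; ring.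
rewrite integral_sum//; last first.
  by move=> i; apply: integrable_sum => // j _; exact: integrableZl.
rewrite -sumEFin; apply: eq_bigr => i _.
rewrite integral_sum//; last by move=> j; exact: integrableZl.
rewrite -sumEFin; apply: eq_bigr => j _.
by rewrite integralZl// cX.
Qed.

Lemma integral_lincomb0 n (X : 'I_n -> T -> R) (b : 'I_n -> R) :
  (forall i, P.-integrable setT (EFin \o X i)) ->
  (forall i, \int[P]_w (X i w)%:E = 0)%E ->
  (\int[P]_w (\sum_(i < n) b i * X i w)%:E = 0)%E.
Proof.
move=> iX X0.
under eq_integral do rewrite -sumEFin.
rewrite integral_sum//; last first.
  by move=> i; under eq_fun do rewrite EFinM; apply: integrableZl => //; exact: iX.
rewrite big1// => i _.
under eq_integral do rewrite EFinM.
by rewrite (integralZl measurableT (iX i)) /= X0 mule0.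
Qed.

End square_integrable.

Definition fbm_cov (R : realType) (H s t : R) : R :=
  2^-1 * (t `^ (2 * H) + s `^ (2 * H) - `|t - s| `^ (2 * H)).

Section fbm.
Context d (Omega : measurableType d) (R : realType) (P : probability Omega R).
Context (H : R) (W : R -> {RV P >-> R}).
Hypothesis H_gt0 : 0 < H.
Hypothesis W_fBm : is_fBm P H W.

Let gaussW : is_gaussian_process P W. Proof. by case: W_fBm. Qed.

Lemma fbm_integral_mul s t : 0 <= s -> 0 <= t ->
  (\int[P]_w (W s w * W t w)%:E = (fbm_cov H s t)%:E)%E.
Proof.
case: W_fBm => _ _ meanW _ covW s0 t0.
rewrite -(covW _ _ s0 t0) [in RHS]unlock !meanW//= unlock.
by apply: eq_integral => w _; rewrite /= !fctE/= !subr0.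
Qed.

Lemma fbm_integrable_mul s t : 0 <= s -> 0 <= t ->
  P.-integrable setT (fun w => (W s w * W t w)%:E).
Proof.
move=> s0 t0.
have sqW r : 0 <= r -> P.-integrable setT (fun w => (W r w ^+ 2)%:E).
  move=> r0; apply/integrableP; split.
    by apply/measurable_EFinP; exact: measurable_funX.
  under eq_integral do rewrite gee0_abs ?lee_fin ?sqr_ge0//.
  under eq_integral do rewrite expr2.
  by rewrite (fbm_integral_mul r0 r0) ltry.
by apply: integrable_mul_sqr => //; exact: sqW.
Qed.

Lemma fbm_integrable t : 0 <= t -> P.-integrable setT (EFin \o W t).
Proof.
move=> t0; apply: integrable_of_sqr => //.
exact: fbm_integrable_mul.
Qed.

Lemma fbm_mean t : 0 <= t -> (\int[P]_w (W t w)%:E = 0)%E.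
Proof.
by move=> t0; case: W_fBm => _ _ + _ _ => /(_ _ t0); rewrite unlock.
Qed.

Lemma fbm_lincomb_gaussian n (t a : 'I_n -> R) : (forall i, 0 <= t i) ->
  centred_gaussian P (fun w => \sum_(i < n) a i * W (t i) w)
    (\sum_(i < n) \sum_(j < n) a i * a j * fbm_cov H (t i) (t j)).
Proof.
move=> t0; split.
- apply: measurable_sum => i; exact: measurable_funM.
- exact: gaussW.
- apply: integral_lincomb0 => i; first exact: fbm_integrable.
  exact: fbm_mean.
- apply: integral_sqr_lincomb => i j; first exact: fbm_integrable_mul.
  exact: fbm_integral_mul.
Qed.

Lemma fbm_covxx t : fbm_cov H t t = t `^ (2 * H).
Proof.
rewrite /fbm_cov subrr normr0 powR0 ?subr0; first by field.
by rewrite mulf_neq0// gt_eqF.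
Qed.

Lemma fbm_gaussian t : 0 <= t -> centred_gaussian P (W t) (t `^ (2 * H)).
Proof.
move=> t0; have := @fbm_lincomb_gaussian 1 (fun _ => t) (fun _ => 1) (fun _ => t0).
rewrite !big_ord1 !mul1r fbm_covxx; congr centred_gaussian.
by apply/funext => w; rewrite big_ord1 mul1r.
Qed.

Lemma fbm_increment_gaussian s t : 0 <= s -> 0 <= t ->
  centred_gaussian P (fun w => W t w - W s w) (`|t - s| `^ (2 * H)).
Proof.
move=> s0 t0.
have ts0 (i : 'I_2) : 0 <= (if i == 0 then t else s) by case: ifP.
have := fbm_lincomb_gaussian (fun i : 'I_2 => if i == 0 then 1 else -1) ts0.
congr centred_gaussian.
  by apply/funext => w; rewrite !big_ord_recl big_ord0 /= mul1r mulN1r addr0.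
rewrite !big_ord_recl !big_ord0 /= !fbm_covxx !addr0.
by rewrite /fbm_cov (distrC s t); field.
Qed.

(** Increments looking back from time [t] have the covariance of the process
    itself, because the covariance depends on increments only. *)
Lemma fbm_cov_reversal s r t :
  fbm_cov H t t - fbm_cov H t r - fbm_cov H s t + fbm_cov H s r =
  fbm_cov H (t - s) (t - r) + 2^-1 * ((`|t - s| `^ (2 * H) - (t - s) `^ (2 * H))
    + (`|t - r| `^ (2 * H) - (t - r) `^ (2 * H))).
Proof.
rewrite fbm_covxx /fbm_cov (distrC r t) (_ : t - r - (t - s) = s - r); last by ring.
by rewrite (distrC r s); field.
Qed.

(** Both families have the same covariances by [fbm_cov_reversal], whose last
    terms vanish for times in [[0, t]]. *)
Lemma fbm_reversed_gaussian n (t : R) (s b : 'I_n -> R) :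
  0 <= t -> (forall i, 0 <= s i <= t) ->
  let v := \sum_(i < n) \sum_(j < n) b i * b j * fbm_cov H (t - s i) (t - s j) in
  centred_gaussian P (fun w => \sum_(i < n) b i * (W t w - W (s i) w)) v /\
  centred_gaussian P (fun w => \sum_(i < n) b i * W (t - s i) w) v.
Proof.
move=> t0 st v.
have s0 i : 0 <= s i by have /andP[] := st i.
have ts0 i : 0 <= t - s i by have /andP[] := st i; rewrite subr_ge0.
split; last exact: fbm_lincomb_gaussian.
have iW i : P.-integrable setT (EFin \o (fun w => W t w - W (s i) w)).
  have -> : EFin \o (fun w => W t w - W (s i) w) =
     ((EFin \o W t) \- (EFin \o W (s i)))%E by [].
  by apply: integrableB => //; apply: fbm_integrable.
have mulE i j : (fun w => ((W t w - W (s i) w) * (W t w - W (s j) w))%:E) =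
  (fun w => ((W t w * W t w)%:E - (W t w * W (s j) w)%:E) -
    ((W (s i) w * W t w)%:E - (W (s i) w * W (s j) w)%:E))%E.
  by apply/funext => w; rewrite -!EFinB; congr EFin; ring.
have iM := fbm_integrable_mul.
split.
- apply: measurable_sum => i; apply: measurable_funM => //.
  exact: measurable_funB.
  (* a combination of increments is one of values, [W t] having as coefficient
     the sum of all the [b k] *)
- pose t' (i : 'I_n.+1) := if unlift ord0 i is Some j then s j else t.
  pose b' (i : 'I_n.+1) := if unlift ord0 i is Some j then - b j else \sum_(k < n) b k.
  have [|m [v' lawX]] := gaussW (t := t') b'.
    by move=> i; rewrite /t'; case: unlift.
  exists m, v' => A mA; rewrite -lawX//; congr (P _); apply/seteqP.
  have E w : \sum_(i < n) b i * (W t w - W (s i) w) = \sum_(i < n.+1) b' i * W (t' i) w.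
    rewrite big_ord_recl /b' /t' unlift_none mulr_suml -big_split/=.
    by apply: eq_bigr => i _; rewrite liftK mulrBr mulNr.
  by split => w /=; rewrite E.
- apply: integral_lincomb0 => i; first exact: iW.
  under eq_integral do rewrite EFinB.
  by rewrite integralB// ?fbm_mean ?sube0//; exact: fbm_integrable.
- apply: integral_sqr_lincomb => i j; rewrite ?mulE.
    by repeat (apply: integrableB => //); exact: iM.
  rewrite integralB//; last 2 first.
  + by apply: integrableB => //; exact: iM.
  + by apply: integrableB => //; exact: iM.
  rewrite integralB ?iM//; try exact: iM.
  rewrite integralB ?iM//; try exact: iM.
  rewrite !fbm_integral_mul// -!EFinB; congr EFin.
  have := fbm_cov_reversal (s i) (s j) t.
  rewrite !ger0_norm// !subrr addr0 mulr0 addr0 => <-; ring.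
Qed.

End fbm.

(** * Linear marginals determine orthant probabilities *)

Lemma integrable_bounded d (T : measurableType d) (R : realType)
    (P : probability T R) (f : T -> R) (M : R) :
  measurable_fun setT f -> (forall w, `|f w| <= M) ->
  P.-integrable setT (EFin \o f).
Proof.
move=> mf fM; apply: measurable_bounded_integrable => //.
  exact: le_lt_trans (probability_le1 P measurableT) (ltry _).
exists M; split; first exact: num_real.
by move=> x Mx w _ /=; rewrite (le_trans (fM w))// ltW.
Qed.

Section sign_polynomial.
Context {R : realType}.
Implicit Types s : R.

(** An odd cubic whose iterates on [[-1, 1]] converge to the sign: this makes the
    sign of a function a limit of polynomials in it. *)
Definition sign_step s : R := 2^-1 * (3 * s - s * s * s).

Lemma sign_step_bounds s : 0 <= s <= 1 ->
  s <= sign_step s <= 1 /\ 1 - sign_step s <= (1 - s) * (1 - s / 2).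
Proof.
move=> /andP[s0 s1]; rewrite /sign_step.
have s1' : 0 <= 1 - s by rewrite subr_ge0.
have h1 : 0 <= s * (1 - s) by rewrite mulr_ge0.
have h2 : 0 <= s * (1 - s) * s by rewrite mulr_ge0.
have h3 : 0 <= (1 - s) * (1 - s) * (2 + s) by rewrite !mulr_ge0//; lra.
have h4 : 0 <= s * (1 - s) * (1 - s) by rewrite mulr_ge0.
split; first by apply/andP; split; nra.
nra.
Qed.

Lemma sign_stepN s : sign_step (- s) = - sign_step s.
Proof. by rewrite /sign_step; ring. Qed.

Lemma iter_sign_step_bounds k s : 0 <= s <= 1 ->
  s <= iter k sign_step s <= 1 /\
  1 - iter k sign_step s <= (1 - s / 2) ^+ k.
Proof.
move=> /andP[s0 s1]; elim: k => [|k [/andP[IH1 IH2] IH3]] /=.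
  by rewrite lexx s1 expr0; split => //; lra.
have [/andP[h1 h2] h3] := sign_step_bounds (s := iter k sign_step s) ltac:(by apply/andP; split; lra).
split; first by apply/andP; split => //; lra.
apply: (le_trans h3); rewrite exprS mulrC ler_pM//; lra.
Qed.

(** The cubic has the stable fixed points -1 and 1 and the unstable fixed point 0. *)
Lemma cvg_iter_sign_step s : -1 <= s <= 1 ->
  iter k sign_step s @[k --> \oo] --> Num.sg s.
Proof.
have pos r : 0 < r -> r <= 1 -> iter k sign_step r @[k --> \oo] --> (1 : R).
  move=> r0 r1.
  have r01 : 0 <= r <= 1 by rewrite ltW.
  apply: (@squeeze_cvgr _ _ _ _ (fun k => 1 - (1 - r / 2) ^+ k) (cst 1)).
  - apply: nearW => k; have [/andP[_ h1] h2] := iter_sign_step_bounds k r01.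
    by apply/andP; split => //; lra.
  - rewrite -[X in _ --> X]subr0; apply: cvgB; first exact: cvg_cst.
    by apply: cvg_expr; rewrite ger0_norm; lra.
  - exact: cvg_cst.
move=> /andP[sN1 s1]; have [s0|s0|->] := ltgtP s 0.
- rewrite ltr0_sg//.
  have itN k r : iter k sign_step (- r) = - iter k sign_step r.
    by elim: k => //= k ->; rewrite sign_stepN.
  have -> : (fun k => iter k sign_step s) = (fun k => - iter k sign_step (- s)).
    by apply/funext => k; rewrite itN opprK.
  by apply: cvgN; apply: pos; lra.
- by rewrite gtr0_sg//; exact: pos.
- rewrite sgr0; have -> : (fun k => iter k sign_step 0) = cst (0 : R).
    by apply/funext => k; elim: k => //= k ->; rewrite /sign_step; ring.
  exact: cvg_cst.
Qed.

End sign_polynomial.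

Section cramer_wold.
Context d (T : measurableType d) (R : realType) (P : probability T R).
Context (n : nat) (Y Z : 'I_n -> T -> R).
Hypothesis mY : forall i, measurable_fun setT (Y i).
Hypothesis mZ : forall i, measurable_fun setT (Z i).
Hypothesis YZ : forall (b : 'I_n -> R) (A : set R), measurable A ->
  P [set w | A (\sum_(i < n) b i * Y i w)] =
  P [set w | A (\sum_(i < n) b i * Z i w)].
Implicit Types F G : ('I_n -> R) -> R.

Let bdd_meas F := [/\ exists M : R, forall y, `|F y| <= M,
  measurable_fun setT (fun w => F (Y ^~ w)) &
  measurable_fun setT (fun w => F (Z ^~ w))].

Let same F := (\int[P]_w (F (Y ^~ w))%:E = \int[P]_w (F (Z ^~ w))%:E)%E.

Let ridge (a : 'I_n -> R) (b : R) y := cos (\sum_(i < n) a i * y i + b).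

(** The factors [ridge a b] make [good] testable on products: multiplying by a
    further ridge function only changes [a] and [b]. *)
Let good G := bdd_meas G /\ forall a b, same (fun y => G y * ridge a b y).

(** The multipliers of [good] form an algebra that contains the ridge functions
    and is stable under bounded pointwise limits. Pointwise limits suffice to
    reach indicators, without the uniform approximation of a Stone-Weierstrass
    argument. *)
Let mult F := bdd_meas F /\ forall G, good G -> good (fun y => F y * G y).

Let bdd_lin k F G : bdd_meas F -> bdd_meas G -> bdd_meas (fun y => k * F y + G y).
Proof.
move=> [[M FM] mFY mFZ] [[N GN] mGY mGZ]; split.
- exists (`|k| * M + N) => y; rewrite (le_trans (ler_normD _ _))// lerD//.
  by rewrite normrM ler_wpM2l.
- by apply: measurable_funD => //; exact: measurable_funM.
- by apply: measurable_funD => //; exact: measurable_funM.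
Qed.

Let bdd_mul F G : bdd_meas F -> bdd_meas G -> bdd_meas (fun y => F y * G y).
Proof.
move=> [[M FM] mFY mFZ] [[N GN] mGY mGZ]; split.
- by exists (M * N) => y; rewrite normrM ler_pM.
- exact: measurable_funM.
- exact: measurable_funM.
Qed.

Let bdd_ridge a b : bdd_meas (ridge a b).
Proof.
have mcos : measurable_fun setT (@cos R).
  by apply: continuous_measurable_fun; exact: continuous_cos.
split; first by exists 1 => y; rewrite ler_norml cos_geN1 cos_le1.
- apply: (measurableT_comp mcos).
  by apply: measurable_funD => //; apply: measurable_sum => i; exact: measurable_funM.
- apply: (measurableT_comp mcos).
  by apply: measurable_funD => //; apply: measurable_sum => i; exact: measurable_funM.
Qed.

Let bdd_lim (F_ : nat -> ('I_n -> R) -> R) F (M : R) :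
  (forall k, bdd_meas (F_ k)) -> (forall k y, `|F_ k y| <= M) ->
  (forall y, F_ k y @[k --> \oo] --> F y) -> bdd_meas F.
Proof.
move=> mF FM cF; split.
- exists M => y.
  have c : (fun k => `|F_ k y|) @ \oo --> `|F y| by apply: cvg_norm; exact: cF.
  by apply: (ler_cvg_to c (cvg_cst M)); apply: nearW => k; exact: FM.
- apply: (@measurable_fun_cvg _ _ _ _ (fun k w => F_ k (Y ^~ w))) => // k.
  by have [] := mF k.
- apply: (@measurable_fun_cvg _ _ _ _ (fun k w => F_ k (Z ^~ w))) => // k.
  by have [] := mF k.
Qed.

Let int_bddY F : bdd_meas F -> P.-integrable setT (fun w => (F (Y ^~ w))%:E).
Proof. by move=> [[M FM] mF _]; exact: integrable_bounded (fun w => FM (Y ^~ w)). Qed.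

Let int_bddZ F : bdd_meas F -> P.-integrable setT (fun w => (F (Z ^~ w))%:E).
Proof. by move=> [[M FM] _ mF]; exact: integrable_bounded (fun w => FM (Z ^~ w)). Qed.

Let same_lin k F G : bdd_meas F -> bdd_meas G -> same F -> same G ->
  same (fun y => k * F y + G y).
Proof.
move=> bF bG sF sG; rewrite /same.
under eq_integral do rewrite EFinD EFinM.
under [RHS]eq_integral do rewrite EFinD EFinM.
rewrite integralD//; [|exact: integrableZl (int_bddY bF)|exact: int_bddY].
rewrite integralD//; [|exact: integrableZl (int_bddZ bF)|exact: int_bddZ].
rewrite (integralZl measurableT (int_bddY bF)) (integralZl measurableT (int_bddZ bF)).
by rewrite [X in (_ * X + _)%E]sF [X in (_ + X)%E]sG.
Qed.

Let same_lim (F_ : nat -> ('I_n -> R) -> R) F (M : R) :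
  (forall k, bdd_meas (F_ k)) -> (forall k y, `|F_ k y| <= M) ->
  (forall y, F_ k y @[k --> \oo] --> F y) -> (forall k, same (F_ k)) -> same F.
Proof.
move=> mF FM cF sF; have bF := bdd_lim mF FM cF.
have iM : P.-integrable setT (fun=> M%:E) by exact: finite_measure_integrable_cst.
have [||||_ _ cY] := @dominated_convergence _ _ _ P setT measurableT
  (fun k w => (F_ k (Y ^~ w))%:E) (fun w => (F (Y ^~ w))%:E) (cst M%:E) _ _ _ iM.
- by move=> k; apply/measurable_EFinP; have [] := mF k.
- by apply/measurable_EFinP; have [] := bF.
- by apply: aeW => w _; apply: cvg_EFin; [exact: nearW|exact: cF].
- by apply: aeW => w k _; rewrite lee_fin.
have [||||_ _ cZ] := @dominated_convergence _ _ _ P setT measurableT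
  (fun k w => (F_ k (Z ^~ w))%:E) (fun w => (F (Z ^~ w))%:E) (cst M%:E) _ _ _ iM.
- by move=> k; apply/measurable_EFinP; have [] := mF k.
- by apply/measurable_EFinP; have [] := bF.
- by apply: aeW => w _; apply: cvg_EFin; [exact: nearW|exact: cF].
- by apply: aeW => w k _; rewrite lee_fin.
rewrite /same -(cvg_lim _ cY)// -(cvg_lim _ cZ)//; congr (lim (_ @ \oo)).
by apply/funext => k; exact: sF.
Qed.

(** A ridge function depends on a single linear combination, whose law is the same
    for both families. *)
Let same_ridge a b : same (ridge a b).
Proof.
have mc : measurable_fun [set: measurableTypeR R] (fun x : R => (cos (x + b))%:E).
  apply/measurable_EFinP; apply: continuous_measurable_fun => x.
  apply: continuous_comp; last exact: continuous_cos.
  by apply: cvgD; [exact: cvg_id|exact: cvg_cst].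
pose LY := (fun w => \sum_(i < n) a i * Y i w) : T -> measurableTypeR R.
pose LZ := (fun w => \sum_(i < n) a i * Z i w) : T -> measurableTypeR R.
have mLY : measurable_fun setT LY.
  by apply: measurable_sum => i; exact: measurable_funM.
have mLZ : measurable_fun setT LZ.
  by apply: measurable_sum => i; exact: measurable_funM.
transitivity (\int[pushforward P LY]_x (cos (x + b))%:E)%E.
  by rewrite integral_pushforward//; exact: int_bddY (bdd_ridge a b).
transitivity (\int[pushforward P LZ]_x (cos (x + b))%:E)%E; last first.
  by rewrite integral_pushforward//; exact: int_bddZ (bdd_ridge a b).
by apply: eq_measure_integral => A mA _; exact: YZ.
Qed.

Let bdd_cst k : bdd_meas (fun=> k).
Proof. by split; [by exists `|k| |exact: measurable_cst|exact: measurable_cst]. Qed.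

Let good1 : good (fun=> 1).
Proof.
split; first exact: bdd_cst.
by move=> a b; under eq_fun do rewrite mul1r; exact: same_ridge.
Qed.

Let good_lin k F G : good F -> good G -> good (fun y => k * F y + G y).
Proof.
move=> [bF sF] [bG sG]; split; first exact: bdd_lin.
move=> a b.
have -> : (fun y => (k * F y + G y) * ridge a b y) =
    (fun y => k * (F y * ridge a b y) + G y * ridge a b y).
  by apply/funext => y; ring.
by apply: same_lin => //; apply: bdd_mul => //; exact: bdd_ridge.
Qed.

Let good_lim (F_ : nat -> ('I_n -> R) -> R) F (M : R) :
  (forall k, good (F_ k)) -> (forall k y, `|F_ k y| <= M) ->
  (forall y, F_ k y @[k --> \oo] --> F y) -> good F.
Proof.
move=> gF FM cF; split; first by apply: bdd_lim FM cF => k; have [] := gF k.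
move=> a b; apply: (@same_lim (fun k y => F_ k y * ridge a b y) _ M).
- by move=> k; apply: bdd_mul; [have [] := gF k|exact: bdd_ridge].
- move=> k y; rewrite normrM -[leRHS]mulr1 ler_pM//.
  by rewrite ler_norml cos_geN1 cos_le1.
- by move=> y; apply: cvgM; [exact: cF|exact: cvg_cst].
- by move=> k; have [_] := gF k; exact.
Qed.

Let mult_cst k : mult (fun=> k).
Proof.
split; first exact: bdd_cst.
move=> G gG; have := @good_lin (k - 1) _ _ gG gG.
by congr good; apply/funext => y; ring.
Qed.

Let mult_lin k F G : mult F -> mult G -> mult (fun y => k * F y + G y).
Proof.
move=> [bF mF] [bG mG]; split; first exact: bdd_lin.
move=> H gH; have := @good_lin k _ _ (mF _ gH) (mG _ gH).
by congr good; apply/funext => y; ring.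
Qed.

Let mult_mul F G : mult F -> mult G -> mult (fun y => F y * G y).
Proof.
move=> [bF mF] [bG mG]; split; first exact: bdd_mul.
move=> H gH; have := mF _ (mG _ gH).
by congr good; apply/funext => y; ring.
Qed.

Let mult_lim (F_ : nat -> ('I_n -> R) -> R) F (M : R) :
  (forall k, mult (F_ k)) -> (forall k y, `|F_ k y| <= M) ->
  (forall y, F_ k y @[k --> \oo] --> F y) -> mult F.
Proof.
move=> mF FM cF; split; first by apply: bdd_lim FM cF => k; have [] := mF k.
move=> G gG; have [[[N GN] _ _] _] := gG.
apply: (@good_lim (fun k y => F_ k y * G y) _ (M * N)).
- by move=> k; have [_] := mF k; exact.
- by move=> k y; rewrite normrM ler_pM.
- by move=> y; apply: cvgM; [exact: cF|exact: cvg_cst].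
Qed.

(** Product-to-sum formula for cosines. *)
Let mult_ridge a b : mult (ridge a b).
Proof.
split; first exact: bdd_ridge.
move=> G [bG sG]; split; first by apply: bdd_mul => //; exact: bdd_ridge.
move=> a' b'.
have -> : (fun y => ridge a b y * G y * ridge a' b' y) =
  (fun y => 2^-1 * (G y * ridge (fun i => a i + a' i) (b + b') y) +
    (2^-1 * (G y * ridge (fun i => a i - a' i) (b - b') y) + 0)).
  apply/funext => y; rewrite /ridge.
  have -> : \sum_(i < n) (a i + a' i) * y i + (b + b') =
    (\sum_(i < n) a i * y i + b) + (\sum_(i < n) a' i * y i + b').
    by under eq_bigr do rewrite mulrDl; rewrite big_split/=; ring.
  have -> : \sum_(i < n) (a i - a' i) * y i + (b - b') =
    (\sum_(i < n) a i * y i + b) - (\sum_(i < n) a' i * y i + b').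
    by under eq_bigr do rewrite mulrBl; rewrite sumrB/=; ring.
  move: (_ + b) (_ + b') => A B.
  by rewrite cosD cosB; field.
apply: same_lin => //.
- by apply: bdd_mul => //; exact: bdd_ridge.
- apply: bdd_lin; last exact: bdd_cst.
  by apply: bdd_mul => //; exact: bdd_ridge.
- by apply: same_lin => //; apply: bdd_mul => //; exact: bdd_ridge.
Qed.

Let mult_sin i c (N : R) : mult (fun y => sin ((y i - c) * N)).
Proof.
have := mult_ridge (fun j => if j == i then - N else 0) (pi / 2 + c * N).
congr mult; apply/funext => y; rewrite /ridge.
rewrite (bigD1 i)//= eqxx big1 ?addr0; last first.
  by move=> j /negbTE ->; rewrite mul0r.
by rewrite -cosBpihalf -cosN; congr cos; ring.
Qed.

Let mult_sg_sin i c (N : R) : mult (fun y => Num.sg (sin ((y i - c) * N))).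
Proof.
have sb (x : R) : -1 <= sin x <= 1 by rewrite sin_geN1 sin_le1.
apply: (@mult_lim (fun k y => iter k sign_step (sin ((y i - c) * N))) _ 1).
- elim => [|k IH] /=; first exact: mult_sin.
  have := mult_lin (- 2^-1) (mult_mul (mult_mul IH IH) IH)
     (mult_lin (3 / 2) IH (mult_cst 0)).
  by congr mult; apply/funext => y; rewrite /sign_step; field.
- move=> k y; move: (sin _) (sb ((y i - c) * N)) => s.
  elim: k => [|k IH] s1 /=; first by rewrite ler_norml.
  move: (IH s1); set r := iter _ _ _ => r1.
  have [r0|r0] := leP 0 r.
    have r01 : 0 <= r <= 1 by rewrite r0/= -(ger0_norm r0).
    have [/andP[h1 h2] _] := sign_step_bounds r01.
    by rewrite ger0_norm// (le_trans r0).
  have r01 : 0 <= - r <= 1 by rewrite oppr_ge0 ltW//= -(ltr0_norm r0).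
  have [/andP[h1 h2] _] := sign_step_bounds r01.
  rewrite -normrN -sign_stepN ger0_norm// (le_trans _ h1)// oppr_ge0 ltW//.
- by move=> y; exact: cvg_iter_sign_step.
Qed.

(** For large [k], [sin (x / k)] has the sign of [x]. *)
Let mult_sg i c : mult (fun y => Num.sg (y i - c)).
Proof.
apply: (@mult_lim (fun k y => Num.sg (sin ((y i - c) * k.+1%:R^-1))) _ 1).
- by move=> k; exact: mult_sg_sin.
- by move=> k y; rewrite normr_sg; case: (_ != 0).
- move=> y; set x := y i - c.
  have piP (z : R) (k : nat) : 0 < z -> z < pi -> 0 < z * k.+1%:R^-1 < pi.
    move=> z0 zpi; rewrite mulr_gt0//=.
    by rewrite (le_lt_trans _ zpi)// ler_piMr ?(ltW z0)// invf_le1 ?ler1n.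
  have small (z : R) : 0 < z -> \forall k \near \oo, 0 < z * k.+1%:R^-1 < pi.
    move=> z0; near=> k; rewrite mulr_gt0 ?invr_gt0//=.
    rewrite ltr_pdivrMr// mulrC -ltr_pdivrMr ?pi_gt0//.
    near: k; apply: filterS (nbhs_infty_gtr (z / pi)) => k /lt_le_trans; apply.
    by rewrite ler_nat.
  apply: cvg_near_cst.
  have [x0|x0|->] := ltgtP x 0.
  + have xN0 : 0 < - x by rewrite oppr_gt0.
    apply: filterS (small _ xN0) => k; rewrite mulNr => h.
    have := sin_gt0_pi h; rewrite sinN oppr_gt0 => s0.
    by rewrite !ltr0_sg.
  + apply: filterS (small _ x0) => k h.
    by rewrite !gtr0_sg// sin_gt0_pi.
  + by apply: nearW => k; rewrite mul0r sin0.
Unshelve. all: by end_near. Qed.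

(** Steps placed at [c + 1/k] decrease to the indicator of [[y i <= c]], so that
    the jump of the sign is never at [y i = c]. *)
Let mult_le i c : mult (fun y : 'I_n -> R => ((y i <= c)%R%:R : R)).
Proof.
apply: (@mult_lim (fun k y => - 2^-1 * Num.sg (y i - (c + k.+1%:R^-1)) + 2^-1) _ 1).
- by move=> k; apply: mult_lin; [exact: mult_sg|exact: mult_cst].
- move=> k y; have : `|Num.sg (y i - (c + k.+1%:R^-1))| <= 1.
    by rewrite normr_sg; case: (_ != 0).
  by rewrite !ler_norml => /andP[h1 h2]; apply/andP; split; lra.
- move=> y; apply: cvg_near_cst; have [yc|cy] := leP (y i) c.
    apply: nearW => k; rewrite ltr0_sg; first by rewrite /=; field.
    have : 0 < k.+1%:R^-1 :> R by rewrite invr_gt0.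
    by move: (y i) (k.+1%:R^-1) yc => z e; lra.
  near=> k; rewrite gtr0_sg /=; first by field.
  rewrite subr_gt0 -ltrBrDl; near: k.
  exact: (@near_infty_natSinv_lt R (PosNum (ltac:(by rewrite subr_gt0) : 0 < y i - c))).
Unshelve. all: by end_near. Qed.

(** The theorem of Cramer and Wold for orthants: their indicators are products of
    multipliers, and [fun=> 1] is good. *)
Lemma orthant_prob_eq (c : 'I_n -> R) :
  P [set w | forall i, Y i w <= c i] = P [set w | forall i, Z i w <= c i].
Proof.
have mprod (s : seq 'I_n) : mult (fun y : 'I_n -> R => \prod_(i <- s) ((y i <= c i)%R%:R : R)).
  elim: s => [|i s IH].
    by have := mult_cst 1; congr mult; apply/funext => y; rewrite big_nil.
  have := mult_mul (mult_le i (c i)) IH.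
  by congr mult; apply/funext => y; rewrite big_cons.
have [_ /(_ _ good1)[_ /(_ (fun=> 0) 0)]] := mprod (index_enum 'I_n).
have E (X : 'I_n -> T -> R) : (forall i, measurable_fun setT (X i)) ->
   (\int[P]_w (\prod_(i < n) ((X i w <= c i)%R%:R : R) * 1 *
      cos (\sum_(i < n) 0 * X i w + 0))%:E)%E = P [set w | forall i, X i w <= c i].
  move=> mX.
  have mA : measurable [set w | forall i, X i w <= c i].
    have -> : [set w | forall i, X i w <= c i] =
       \bigcap_(i in [set: 'I_n]) [set w | X i w <= c i].
      by apply/seteqP; split => w /= h i; [move=> _|]; exact: h.
    apply: fin_bigcap_measurable; first exact: finite_finset.
    move=> i _; rewrite -[X in measurable X]setTI.
    exact: measurable_fun_ler.
  rewrite -[in RHS](setIT [set w | _]) -integral_indic//.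
  apply: eq_integral => w _; congr EFin.
  have -> : \sum_(i < n) 0 * X i w = 0 by rewrite big1// => i _; rewrite mul0r.
  rewrite addr0 cos0 !mulr1.
  rewrite indicE; have [/set_mem/= h|/negP h] := boolP (w \in _).
    by rewrite big1// => i _; rewrite h.
  have [i /negP] : exists i, ~ (X i w <= c i).
    by apply/existsNP => h'; apply: h; rewrite inE.
  by move=> /negbTE hi; rewrite (bigD1 i)//= hi mul0r.
by rewrite /same /ridge !E.
Qed.

End cramer_wold.

(** Continuity from above along the finite subfamilies. *)
Lemma countable_orthant_prob_eq d (T : measurableType d) (R : realType)
    (P : probability T R) (Y Z : nat -> T -> R) (c : nat -> R) :
  (forall i, measurable_fun setT (Y i)) ->
  (forall i, measurable_fun setT (Z i)) ->
  (forall n (b : 'I_n -> R) (A : set R), measurable A ->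
    P [set w | A (\sum_(i < n) b i * Y i w)] =
    P [set w | A (\sum_(i < n) b i * Z i w)]) ->
  P [set w | forall i, Y i w <= c i] = P [set w | forall i, Z i w <= c i].
Proof.
move=> mY mZ YZ.
have E (X : nat -> T -> R) : (forall i, measurable_fun setT (X i)) ->
    P [set w | forall i : 'I_n, X i w <= c i] @[n --> \oo] -->
    P [set w | forall i, X i w <= c i].
  move=> mX; pose F n := [set w | forall i : 'I_n, X i w <= c i].
  have -> : [set w | forall i, X i w <= c i] = \bigcap_n F n.
    apply/seteqP; split => w /=; first by move=> h n _ i; exact: h.
    by move=> h i; exact: (h i.+1 Logic.I (Ordinal (ltnSn i))).
  have mF n : measurable (F n).
    have -> : F n = \bigcap_(i in [set: 'I_n]) [set w | X i w <= c i].
      by apply/seteqP; split => w /= h i; [move=> _|]; exact: h.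
    apply: fin_bigcap_measurable; first exact: finite_finset.
    move=> i _; rewrite -[X in measurable X]setTI.
    exact: measurable_fun_ler.
  apply: nonincreasing_cvg_mu => //.
  - exact: le_lt_trans (probability_le1 P (mF _)) (ltry _).
  - exact: bigcapT_measurable.
  - move=> m n mn; apply/subsetPset => w /= h i.
    exact: (h (widen_ord mn i)).
have EY := E _ mY; have EZ := E _ mZ.
rewrite -(cvg_lim _ EY)// -(cvg_lim _ EZ)//; congr (lim (_ @ \oo)).
apply/funext => n.
apply: (@orthant_prob_eq _ _ _ P n (fun i => Y i) (fun i => Z i) _ _ _
  (fun i => c i)) => [i|i|]; [exact: mY|exact: mZ|exact: YZ].
Qed.

(** Both families are Gaussian with the same covariance, because the covariance
    of fractional Brownian motion depends on increments only: seen from time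
    [t], its past is again a fractional Brownian motion. *)
Lemma fbm_reversal_prob d (Omega : measurableType d) (R : realType)
    (P : probability Omega R) (H : R) (W : R -> {RV P >-> R})
    (t : R) (s c : nat -> R) :
  0 < H -> is_fBm P H W -> 0 <= t -> (forall k, 0 <= s k <= t) ->
  P [set w | forall k, W t w - W (s k) w <= c k] =
  P [set w | forall k, W (t - s k) w <= c k].
Proof.
move=> H0 WH t0 st; apply: countable_orthant_prob_eq => //.
- by move=> i; exact: measurable_funB.
move=> n b A mA.
have [] := fbm_reversed_gaussian (n := n) H0 WH (s := fun i => s i) b t0 (fun i => st i).
by move=> gY gZ; exact: (centred_gaussian_unique gY gZ).
Qed.

(** * Continuous paths *)

Section paths.
Context {R : realType}.
Implicit Types (f g w : R -> R) (x u t s c : R).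

Lemma within_continuous_comp (A : set R) f (k : R -> R) : {within A, continuous f} ->
  continuous k -> (forall x, A (k x)) -> continuous (f \o k).
Proof.
move=> /continuousP cf ck Ak; apply/continuousP => U oU.
have [V oV VA] := (open_subspaceP A (f @^-1` U)).1 (cf U oU).
have -> : (f \o k) @^-1` U = k @^-1` V.
  apply/seteqP; split => x /= Ux.
    have : ((f @^-1` U) `&` A) (k x) by [].
    by rewrite -VA => -[].
  have : (V `&` A) (k x) by [].
  by rewrite VA => -[].
by move/continuousP : ck; exact.
Qed.

Lemma continuous_max0 : continuous (fun x : R => Num.max 0 x).
Proof. by move=> x; apply: continuous_max; [exact: cvg_cst|exact: cvg_id]. Qed.

(** Freezing the path at negative times turns continuity on the half line into
    continuity everywhere. *)
Lemma continuous_pos_path w : {within `[0, +oo[, continuous w} ->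
  continuous (fun t => w (Num.max 0 t)).
Proof.
move=> cw; apply: (within_continuous_comp cw continuous_max0) => x.
by rewrite /= in_itv/= andbT le_max lexx.
Qed.

(** An enumeration, with repetitions, of the rationals of [[0, 1]]. These countably
    many fractions of [t] decide the extrema over [[0, t]] of a continuous path. *)
Definition unit_rat (k : nat) : R :=
  Num.max 0 (Num.min 1 (if unpickle k is Some q then ratr q else 0)).

Lemma unit_rat_itv k : 0 <= unit_rat k <= 1.
Proof. by rewrite /unit_rat le_max lexx ge_max ler01 ge_min lexx. Qed.

Lemma ratr_dense_le g c : continuous g -> (forall q : rat, g (ratr q) <= c) ->
  forall s, g s <= c.
Proof.
move=> cg gc s; rewrite leNgt; apply/negP => cgs.
have oU : open (g @^-1` [set y | c < y]).
  by move/continuousP : cg; apply; exact: open_gt.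
have [y [/= Uy [q _ qy]]] := @dense_rat R _ (ex_intro _ s cgs) oU.
by have := gc q; rewrite qy leNgt Uy.
Qed.

Lemma unit_rat_dense g c : continuous g -> (forall k, g (unit_rat k) <= c) ->
  forall s, 0 <= s <= 1 -> g s <= c.
Proof.
move=> cg gc s /andP[s0 s1].
have ck : continuous (fun x : R => Num.max 0 (Num.min 1 x)).
  move=> x; apply: continuous_max; first exact: cvg_cst.
  by apply: continuous_min; [exact: cvg_cst|exact: cvg_id].
rewrite -(max_idPr s0) -{1}(min_idPr s1).
apply: (@ratr_dense_le (g \o (fun x : R => Num.max 0 (Num.min 1 x))) c).
  by move=> x; apply: continuous_comp; [exact: ck|exact: cg].
by move=> q; have := gc (pickle q); rewrite /unit_rat pickleK.
Qed.

Section bounded_time.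
Variables (x u t : R) (w : R -> R).
Hypothesis t0 : 0 <= t.
Hypothesis cw : {within `[0, +oo[, continuous w}.

Let cwt (q : R) : 0 <= q -> continuous (fun s => w (Num.max 0 (q * s))).
Proof.
move=> q0 s; apply: (@continuous_comp _ _ _ (fun s => q * s) (fun s => w (Num.max 0 s))).
  by apply: cvgM; [exact: cvg_cst|exact: cvg_id].
exact: continuous_pos_path.
Qed.

Lemma path_lin_continuous (a b : R) : {within `[0, t], continuous (fun s => a + b * s + w s)}.
Proof.
have cl : {within `[0, t], continuous (fun s => a + b * s + w (Num.max 0 s))}.
  apply: continuous_subspaceT => s; apply: cvgD; last exact: continuous_pos_path.
  by apply: cvgD; [exact: cvg_cst|apply: cvgM; [exact: cvg_cst|exact: cvg_id]].
apply: (@subspace_eq_continuous _ _ _ (fun s => a + b * s + w (Num.max 0 s))) cl.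
by move=> s; rewrite inE/= in_itv/= => /andP[s0 _]; rewrite (max_idPr s0).
Qed.

(** The content is the largest of the contents that start from [x] at time [0] or
    from [0] at a time [s <= t]. The countable form serves for measurability and
    for the comparison under time reversal. *)
Lemma reflected_leP c : reflected x u w t <= c <->
  x - u * t + w t <= c /\
  forall k, w t - w (t * unit_rat k) <= c + u * (t - t * unit_rat k).
Proof.
pose y s := x + (- u) * s + w s.
have [m mt ym] := EVT_min t0 (path_lin_continuous (a := x) (b := - u)).
have infE : inf [set x - u * s + w s | s in `[0, t]] = y m.
  have -> : [set x - u * s + w s | s in `[0, t]] = y @` `[0, t].
    by apply: eq_imagel => s _; rewrite /y mulNr.
  apply/eqP; rewrite eq_le; apply/andP; split.
    by apply: ge_inf; [exists (y m) => _ [s st <-]; exact: ym|exists m].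
  by apply: lb_le_inf; [exists (y m), m|move=> _ [s st <-]; exact: ym].
have -> : (reflected x u w t <= c) <->
    y t <= c /\ forall s, 0 <= s <= t -> y t - y s <= c.
  rewrite /reflected /regulator infE -[x - u * t + w t]/(x - u * t + w t) -mulNr.
  rewrite -[x + - u * t + w t]/(y t) lerBlDr -lerBlDl le_min.
  split.
    move=> /andP[h1 h2]; split; first by lra.
    by move=> s st; have := ym s; rewrite in_itv/= => /(_ st); rewrite -/(y m) -/(y s); lra.
  move=> [h1 h2]; apply/andP; split; first by lra.
  by have := h2 m mt; lra.
rewrite /y -mulNr; split => -[h1 h2]; split=> //.
  move=> k; have /andP[q0 q1] := unit_rat_itv k.
  have := h2 (t * unit_rat k); rewrite mulr_ge0// ler_piMr// => /(_ isT); lra.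
move=> s /andP[s0 st].
have [t00|tn0] := eqVneq t 0.
  have -> : s = t by apply/eqP; rewrite eq_le st t00 s0.
  by rewrite subrr; have := h2 0; rewrite t00 !mul0r !subrr mulr0 addr0.
have tgt0 : 0 < t by rewrite lt_neqAle eq_sym tn0.
pose g q := w t - w (Num.max 0 (t * q)) - u * (t - t * q).
have := @unit_rat_dense g c _ _ (s / t).
rewrite /g mulrCA divff// mulr1 (max_idPr s0) => H.
suff : w t - w s - u * (t - s) <= c by lra.
apply: H.
- move=> q; apply: cvgB; last first.
    apply: cvgM; first exact: cvg_cst.
    apply: cvgB; first exact: cvg_cst.
    by apply: cvgM; [exact: cvg_cst|exact: cvg_id].
  by apply: cvgB; [exact: cvg_cst|exact: cwt].
- move=> k; have /andP[q0 q1] := unit_rat_itv k.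
  rewrite (max_idPr _) ?mulr_ge0//; have := h2 k; lra.
- by rewrite divr_ge0//= ler_pdivrMr// mul1r.
Qed.

(** The fraction [1] of [t] occurs among the [unit_rat k]. *)
Lemma reflected_ge0 : 0 <= reflected x u w t.
Proof.
have [_ /(_ (pickle (1 : rat)))] := (reflected_leP (reflected x u w t)).1 (lexx _).
rewrite /unit_rat pickleK rmorph1 (min_idPl _)// (max_idPr _)// mulr1 !subrr mulr0.
by rewrite addr0.
Qed.

(** The reflected content at time [t] of the time-reversed path. *)
Definition forward_content : R :=
  Num.max (x - u * t + w t) (sup [set w s - u * s | s in `[0, t]]).

Lemma running_sup_leP c : sup [set w s - u * s | s in `[0, t]] <= c <->
  forall s, 0 <= s <= t -> w s - u * s <= c.
Proof.
have [m mt ym] := EVT_max t0 (path_lin_continuous (a := 0) (b := - u)).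
have bnd s : s \in `[0, t] -> w s - u * s <= w m - u * m.
  by move=> st; have := ym s st; lra.
split.
  move=> h s st; apply: le_trans h; apply: ub_le_sup.
    by exists (w m - u * m) => _ [r rt <-]; exact: bnd.
  by exists s => //=; rewrite in_itv.
move=> h; apply: ge_sup.
  by exists (w m - u * m), m.
by move=> _ [s /= st <-]; apply: h; rewrite in_itv in st.
Qed.

Lemma forward_content_leP c : forward_content <= c <->
  x - u * t + w t <= c /\
  forall k, w (t - t * unit_rat k) <= c + u * (t - t * unit_rat k).
Proof.
rewrite /forward_content ge_max.
split => [/andP[h1 /running_sup_leP h2]|[h1 h2]].
  split => // k; have /andP[q0 q1] := unit_rat_itv k.
  have h : 0 <= t - t * unit_rat k <= t.
    by rewrite subr_ge0 ler_piMr//= gerBl mulr_ge0.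
  by have := h2 _ h; lra.
rewrite h1 /=; apply/running_sup_leP => s /andP[s0 st].
have [t00|tn0] := eqVneq t 0.
  have -> : s = t - t * unit_rat 0 by rewrite t00 mul0r subrr; apply/eqP; rewrite eq_le s0 -t00 st.
  by have := h2 0; lra.
have tgt0 : 0 < t by rewrite lt_neqAle eq_sym tn0.
pose g q := w (Num.max 0 (t * (1 - q))) - u * (t * (1 - q)).
have := @unit_rat_dense g c _ _ (1 - s / t).
rewrite /g opprB addrCA subrr addr0 mulrCA divff// mulr1 (max_idPr s0).
apply.
- move=> q; apply: cvgB; last first.
    apply: cvgM; first exact: cvg_cst.
    apply: cvgM; first exact: cvg_cst.
    by apply: cvgB; [exact: cvg_cst|exact: cvg_id].
  have : continuous ((fun s => w (Num.max 0 (t * s))) \o (fun q => 1 - q)).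
    move=> z; apply: continuous_comp; last exact: cwt.
    by apply: cvgB; [exact: cvg_cst|exact: cvg_id].
  exact.
- move=> k; have /andP[q0 q1] := unit_rat_itv k.
  rewrite (max_idPr _); last by rewrite mulr_ge0// subr_ge0.
  have -> : t * (1 - unit_rat k) = t - t * unit_rat k by ring.
  by have := h2 k; lra.
- have : s / t <= 1 by rewrite ler_pdivrMr// mul1r.
  by have : 0 <= s / t; [rewrite divr_ge0|lra].
Qed.

End bounded_time.

End paths.

(** * Chaining *)

Section chaining.
Context {R : realType}.
Implicit Types (f w : R -> R) (A r s u : R).

(** Going from a dyadic point of level [j] to [0] takes at most one increment of
    each level, so that the bounds form a geometric sum. *)
Lemma chaining_dyadic f A r j i : 0 <= A -> 0 <= r < 1 -> f 0 = 0 ->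
  (forall j i, (i < 2 ^ j)%N ->
    `|f (i.+1%:R / 2 ^+ j) - f (i%:R / 2 ^+ j)| <= A * r ^+ j) ->
  (i <= 2 ^ j)%N -> `|f (i%:R / 2 ^+ j)| <= A * (1 - r ^+ j.+1) / (1 - r).
Proof.
move=> A0 /andP[r0 r1] f0 fA; have r1' : 0 < 1 - r by rewrite subr_gt0.
have step (k : nat) : A * r ^+ k + A * (1 - r ^+ k) / (1 - r) =
    A * (1 - r ^+ k.+1) / (1 - r).
  by rewrite exprS; field; rewrite gt_eqF.
elim: j i => [|j IH] i ij.
  rewrite -step expr0 subrr mulr0 mul0r addr0 mulr1.
  case: i ij => [|[|//]] _; first by rewrite mul0r f0 normr0.
  by have := fA 0%N 0%N isT; rewrite expr0 !divr1 f0 subr0 mulr1.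
have half k : k.*2%:R / 2 ^+ j.+1 = k%:R / 2 ^+ j :> R.
  by rewrite -muln2 natrM exprS; field; rewrite expf_neq0// pnatr_eq0.
rewrite -step -[i]odd_double_half; case: (boolP (odd i)) => io.
  rewrite add1n; set k := i./2.
  have kj : (k.*2 < 2 ^ j.+1)%N.
    by rewrite (leq_trans _ ij)// -[X in (_ < X)%N]odd_double_half io.
  have := fA j.+1 k.*2 kj.
  have := IH k; rewrite half => /(_ _) h1 h2.
  have {}h1 : `|f (k%:R / 2 ^+ j)| <= A * (1 - r ^+ j.+1) / (1 - r).
    by apply: h1; move: kj; rewrite expnS mul2n ltn_double => /ltnW.
  rewrite -[f _](subrK (f (k%:R / 2 ^+ j))) (le_trans (ler_normD _ _))// lerD//.
rewrite add0n half; apply: le_trans (IH _ _) _.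
  rewrite -leq_double -[leqRHS]mul2n -expnS (leq_trans _ ij)//.
  by rewrite -[leqRHS]odd_double_half leq_addl.
by rewrite lerDr mulr_ge0// exprn_ge0.
Qed.

Lemma chaining f A r : 0 <= A -> 0 <= r < 1 -> f 0 = 0 ->
  continuous (fun s => f (Num.max 0 s)) ->
  (forall j i, (i < 2 ^ j)%N ->
    `|f (i.+1%:R / 2 ^+ j) - f (i%:R / 2 ^+ j)| <= A * r ^+ j) ->
  forall s, 0 <= s <= 1 -> `|f s| <= A / (1 - r).
Proof.
move=> A0 r01 f0 cf fA s /andP[s0 s1].
have [r0 r1] := andP r01; have r1' : 0 < 1 - r by rewrite subr_gt0.
pose d (j : nat) : R := (Num.truncn (s * 2 ^+ j))%:R / 2 ^+ j.
have p2 (j : nat) : 0 < 2 ^+ j :> R by rewrite exprn_gt0.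
have d0 j : 0 <= d j by rewrite divr_ge0// ltW.
have ds j : d j <= s <= d j + (2^-1) ^+ j.
  have s2 : 0 <= s * 2 ^+ j by rewrite mulr_ge0// ltW.
  have /andP[h1 h2] := truncn_itv s2.
  rewrite /d ler_pdivrMr// h1 exprVn -[X in _ + X]mul1r -mulrDl ler_pdivlMr//.
  by rewrite /= natr1 ltW.
have cd : d j @[j --> \oo] --> s.
  apply: (@squeeze_cvgr _ _ _ _ (fun j => s - (2^-1) ^+ j) (cst s)).
  - by apply: nearW => j; have /andP[h1 h2] := ds j; apply/andP; split => //; lra.
  - rewrite -[X in _ --> X]subr0; apply: cvgB; first exact: cvg_cst.
    by apply: cvg_expr; rewrite ger0_norm; lra.
  - exact: cvg_cst.
have cfd : (fun j => `|f (Num.max 0 (d j))|) @ \oo --> `|f (Num.max 0 s)|.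
  apply: cvg_norm; apply: (@cvg_comp _ _ _ d (fun s => f (Num.max 0 s)) _ (nbhs s)) => //.
  exact: cf.
rewrite (max_idPr s0) in cfd.
apply: (ler_cvg_to cfd (cvg_cst _)); apply: nearW => j.
rewrite (max_idPr (d0 j)).
have tj : (Num.truncn (s * 2 ^+ j) <= 2 ^ j)%N.
  have s2 : 0 <= s * 2 ^+ j by rewrite mulr_ge0// ltW.
  have /andP[h1 _] := truncn_itv s2.
  rewrite -(ler_nat R) natrX (le_trans h1)//.
  by rewrite ler_piMl// ltW.
apply: le_trans (chaining_dyadic A0 r01 f0 fA tj) _.
by rewrite ler_pM2r ?invr_gt0// ler_piMr// gerBl exprn_ge0.
Qed.

Lemma nth_root_exists (m : nat) (b : R) : (0 < m)%N -> 0 <= b ->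
  exists2 A, 0 <= A & A ^+ m = b.
Proof.
move=> m0 b0; exists (b `^ m%:R^-1); first exact: powR_ge0.
by rewrite -powR_mulrn ?powR_ge0// -powRrM mulVf ?powRr1// pnatr_eq0 -lt0n.
Qed.

(** The normalised increments over all the dyadic subintervals of [[n, n + 1]],
    raised to an even power so that their expectations are Gaussian moments. The
    ratio [3/4] is below [1], as chaining requires, and above the ratio
    [2 `^ - H] of the standard deviations from one level to the next. *)
Definition dyadic_energy (m : nat) w (n : nat) : \bar R :=
  (\sum_(0 <= j <oo) \sum_(i < 2 ^ j)
    (((w (n%:R + i.+1%:R / 2 ^+ j) - w (n%:R + i%:R / 2 ^+ j)) / (3 / 4) ^+ j) ^+ (2 * m))%:E)%E.

Let even_ge0 (y : R) m : 0 <= y ^+ (2 * m).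
Proof. by rewrite exprM exprn_ge0// sqr_ge0. Qed.

Lemma dyadic_energy_ge0 m w n : (0 <= dyadic_energy m w n)%E.
Proof. by apply: nneseries_ge0 => j _ _; apply: sume_ge0 => i _; rewrite lee_fin. Qed.

(** Every increment is bounded by the root of order [2 * m] of the whole energy;
    chaining sums the ratio [3/4], whence the factor [4]. *)
Lemma oscillation_le_energy (m n : nat) w s : (0 < m)%N ->
  continuous (fun t : R => w (Num.max 0 t)) -> n%:R <= s <= n.+1%:R ->
  (((w s - w n%:R) ^+ (2 * m))%:E <= (4 ^+ (2 * m))%:E * dyadic_energy m w n)%E.
Proof.
move=> m0 cw /andP[ns sn].
have E0 := dyadic_energy_ge0 m w n.
have [->|Efin] := eqVneq (dyadic_energy m w n) +oo%E.
  by rewrite mulry gtr0_sg ?mul1e ?leey// exprn_gt0.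
have {}Efin : dyadic_energy m w n \is a fin_num.
  by rewrite ge0_fin_numE// lt_neqAle Efin leey.
have m20 : (0 < 2 * m)%N by rewrite muln_gt0.
have [A A0 AE] := nth_root_exists m20 (fine_ge0 E0).
rewrite -(fineK Efin) -AE -EFinM lee_fin -exprMn.
rewrite -[leLHS]ger0_norm// normrX lerXn2r ?nnegrE ?mulr_ge0//.
pose f (t : R) := w (n%:R + t) - w n%:R.
have n0 : 0 <= n%:R :> R by [].
have -> : w s - w n%:R = f (s - n%:R) by rewrite /f [n%:R + _]addrC subrK.
have -> : 4 * A = A / (1 - 3 / 4) by field.
apply: (@chaining f) => //.
- by apply/andP; split; lra.
- by rewrite /f addr0 subrr.
- have -> : (fun t => f (Num.max 0 t)) =
      (fun t => w (Num.max 0 (n%:R + Num.max 0 t)) - w n%:R).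
    apply/funext => t; rewrite /f [in RHS](@max_idPr _ _ 0 _ _)//.
    by rewrite addr_ge0// le_max lexx.
  move=> t; apply: cvgB; last exact: cvg_cst.
  have : continuous ((fun t => w (Num.max 0 t)) \o (fun t => n%:R + Num.max 0 t)).
    move=> z; apply: continuous_comp; last exact: cw.
    by apply: cvgD; [exact: cvg_cst|exact: continuous_max0].
  exact.
- move=> j i ij; rewrite /f opprB addrA subrK.
  have r0 : 0 < (3 / 4) ^+ j :> R by rewrite exprn_gt0//; lra.
  rewrite -ler_pdivrMr//.
  have -> : forall z : R, `|z| / (3 / 4) ^+ j = `|z / (3 / 4) ^+ j|.
    by move=> z; rewrite normrM normfV (gtr0_norm r0).
  rewrite -(@ler_pXn2r _ (2 * m)%N) ?nnegrE//.
  rewrite -normrX [leLHS]ger0_norm// -lee_fin AE fineK//.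
  pose F j := (\sum_(i < 2 ^ j)
    (((w (n%:R + i.+1%:R / 2 ^+ j) - w (n%:R + i%:R / 2 ^+ j)) / (3 / 4) ^+ j) ^+ (2 * m))%:E)%E.
  have F0 k : (0 <= F k)%E by apply: sume_ge0 => l _; rewrite lee_fin.
  apply: (@le_trans _ _ (F j)).
    rewrite /F (bigD1 (Ordinal ij))//= leeDl//.
    by apply: sume_ge0 => l _; rewrite lee_fin.
  apply: le_trans (nneseries_lim_ge j.+1 _); last by move=> k _ _; exact: F0.
  rewrite -[X in (_ <= X)%E]/(\sum_(0 <= k < j.+1) F k)%E big_nat_recr//=.
  by rewrite leeDr//; apply: sume_ge0 => k _; exact: F0.
- by apply/andP; split; lra.
Qed.

End chaining.

(** * Moments of the maximal workload *)

Lemma nneseries_le_partial (R : realType) (v : nat -> \bar R) (M : \bar R) :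
  (forall n, 0 <= v n)%E -> (forall n, \sum_(0 <= k < n) v k <= M)%E ->
  (\sum_(0 <= k <oo) v k <= M)%E.
Proof.
move=> v0 vM; apply: lime_le; last by apply: nearW => n; exact: vM.
by apply: is_cvg_nneseries => n _ _; exact: v0.
Qed.

Lemma nneseries_geometric_le (R : realType) (a r : R) : 0 <= a -> 0 <= r < 1 ->
  (\sum_(0 <= k <oo) (a * r ^+ k)%:E <= (a / (1 - r))%:E)%E.
Proof.
move=> a0 /andP[r0 r1].
have r1' : 0 < 1 - r by rewrite subr_gt0.
apply: nneseries_le_partial => n; first by rewrite lee_fin mulr_ge0// exprn_ge0.
rewrite sumEFin lee_fin.
have -> : \sum_(0 <= k < n) a * r ^+ k = a * (1 - r ^+ n) / (1 - r).
  elim: n => [|n IH]; first by rewrite big_nil expr0 subrr mulr0 mul0r.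
  by rewrite big_nat_recr//= IH exprS; field; rewrite gt_eqF.
by rewrite ler_pM2r ?invr_gt0// ler_piMr// gerBl exprn_ge0.
Qed.

Lemma nneseries_inv_sqr_le (R : realType) (a : R) : 0 <= a ->
  (\sum_(0 <= k <oo) (a * (k.+1%:R ^- 2))%:E <= (2 * a)%:E)%E.
Proof.
move=> a0.
apply: nneseries_le_partial => n; first by rewrite lee_fin mulr_ge0// invr_ge0 exprn_ge0.
rewrite sumEFin lee_fin.
apply: (@le_trans _ _ (a * (2 - 2 / n.+1%:R))); last first.
  by rewrite mulrC ler_wpM2r// gerBl divr_ge0.
elim: n => [|n IH]; first by rewrite big_nil divr1 subrr mulr0.
rewrite big_nat_recr//=; apply: le_trans (lerD IH (lexx _)) _.
rewrite -mulrDr ler_wpM2l//.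
have n0 : 1 <= n.+1%:R :> R by rewrite ler1n.
rewrite -[n.+2%:R]natr1; move: (n.+1%:R) n0 => z z1.
have z0 : 0 < z by lra.
rewrite -subr_ge0 (_ : _ - _ = (z - 1) / (z ^+ 2 * (z + 1))); last first.
  by field; rewrite !gt_eqF// addr_gt0.
by rewrite divr_ge0 ?subr_ge0// mulr_ge0 ?sqr_ge0//; lra.
Qed.

Section fbm_moments.
Context d (Omega : measurableType d) (R : realType) (P : probability Omega R).
Context (H : R) (W : R -> {RV P >-> R}).
Hypothesis H_ge : 2^-1 <= H.
Hypothesis H_lt : H < 1.
Hypothesis W_fBm : is_fBm P H W.

Let H_gt0 : 0 < H. Proof. by apply: lt_le_trans H_ge; rewrite invr_gt0. Qed.

Let H2_ge1 : 1 <= 2 * H.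
Proof. by rewrite -(@ler_pM2l _ 2^-1)// mulrA mulVf// mul1r mulr1. Qed.

Let kap (m : nat) := normal_moment R m / normal_moment R 1 ^+ m.

Let kap_ge0 m : 0 <= kap m.
Proof.
by rewrite divr_ge0 ?normal_moment_ge0// exprn_ge0// normal_moment_ge0.
Qed.

Let even_ge0 (y : R) m : 0 <= y ^+ (2 * m).
Proof. by rewrite exprM exprn_ge0// sqr_ge0. Qed.

Lemma measurable_dyadic_energy m n :
  measurable_fun setT (fun w => dyadic_energy m (fun s => W s w) n).
Proof.
apply: ge0_emeasurable_sum => [j w _ _|j _].
  by apply: sume_ge0 => i _; rewrite lee_fin.
apply: emeasurable_sum => i; apply/measurable_EFinP.
by apply: measurable_funX; apply: measurable_funM => //; exact: measurable_funB.
Qed.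

(** For [1/2 <= H] an increment over an interval of length [1 / 2 ^+ j] has variance
    at most this length; normalising by the square of [(3/4) ^+ j] makes it
    [(8/9) ^+ j]. With [2 ^+ j] increments at level [j], the powers [m] of the
    variances sum to a geometric series of ratio [2 * (8/9) ^+ m], which
    is below [1] from [m = 6] on. *)
Lemma expectation_dyadic_energy_le m n : (6 <= m)%N ->
  (\int[P]_w dyadic_energy m (fun s => W s w) n <=
   (kap m / (1 - 2 * (8 / 9) ^+ m))%:E)%E.
Proof.
move=> m6.
have mT j : measurable_fun setT (fun w => (\sum_(i < 2 ^ j)
    (((W (n%:R + i.+1%:R / 2 ^+ j) w - W (n%:R + i%:R / 2 ^+ j) w) /
      (3 / 4) ^+ j) ^+ (2 * m))%:E)%E).
  apply: emeasurable_sum => i; apply/measurable_EFinP.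
  by apply: measurable_funX; apply: measurable_funM => //; exact: measurable_funB.
rewrite /dyadic_energy integral_nneseries//; last first.
  by move=> j w _; apply: sume_ge0 => i _; rewrite lee_fin.
apply: le_trans (nneseries_geometric_le (kap_ge0 m) _); last first.
  rewrite mulr_ge0//=.
  rewrite -(@ltr_pM2l _ 2^-1)// mulrA mulVf ?mul1r// mulr1.
  apply: (@le_lt_trans _ _ ((8 / 9) ^+ 6)); last by lra.
  by rewrite ler_wiXn2l//; lra.
apply: lee_nneseries => [j _ _|j _].
  apply: integral_ge0 => w _; apply: sume_ge0 => i _; rewrite lee_fin//.
rewrite ge0_integral_sum//; last 2 first.
- move=> i; apply/measurable_EFinP.
  by apply: measurable_funX; apply: measurable_funM => //; exact: measurable_funB.
- by move=> i w _; rewrite lee_fin.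
have r0 : 0 < (3 / 4) ^+ j :> R by rewrite exprn_gt0//; lra.
have p0 : 0 < 2 ^+ j :> R by rewrite exprn_gt0.
apply: (@le_trans _ _ (\sum_(i < 2 ^ j) (kap m * ((8 / 9) ^+ j) ^+ m)%:E)%E).
  apply: lee_sum => i _.
  set t := n%:R + i.+1%:R / 2 ^+ j; set s := n%:R + i%:R / 2 ^+ j.
  have t0 : 0 <= t by rewrite addr_ge0// divr_ge0// ltW.
  have s0 : 0 <= s by rewrite addr_ge0// divr_ge0// ltW.
  have gts := fbm_increment_gaussian H_gt0 W_fBm s0 t0.
  have -> : (\int[P]_w (((W t w - W s w) / (3 / 4) ^+ j) ^+ (2 * m))%:E =
     (((3 / 4) ^+ j) ^- (2 * m))%:E * \int[P]_w ((W t w - W s w) ^+ (2 * m))%:E)%E.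
    rewrite -ge0_integralZl//.
    + by apply: eq_integral => w _; rewrite -EFinM; congr EFin; rewrite exprMn exprVn mulrC.
    + by apply/measurable_EFinP; apply: measurable_funX; exact: measurable_funB.
    + by move=> w _; rewrite lee_fin.
  rewrite (centred_gaussian_moment m gts) -EFinM lee_fin -/(kap m).
  rewrite mulrCA ler_wpM2l//.
  have -> : t - s = 2 ^- j.
    rewrite /t /s -natr1; field; by rewrite gt_eqF.
  rewrite exprM -exprVn -exprMn lerXn2r ?nnegrE//.
  rewrite ger0_norm; last by rewrite invr_ge0 ltW.
  apply: (@le_trans _ _ (((3 / 4) ^+ j) ^- 2 * 2 ^- j)).
    rewrite ler_wpM2l ?invr_ge0 ?sqr_ge0//.
    apply: ge1r_powR; last exact: H2_ge1.
    by rewrite invr_gt0 p0 invf_le1// exprn_ege1//; lra.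
  rewrite -exprAC -!exprVn -exprMn lerXn2r ?nnegrE//; lra.
rewrite sumEFin sumr_const card_ord lee_fin.
rewrite -[leLHS]mulr_natr natrX -mulrA ler_wpM2l//.
by rewrite [leRHS]exprMn [leLHS]mulrC ler_wpM2l// exprAC.
Qed.

(** If [W s - u s >= 0] with [s] in [[n, n + 1]], then the sum of [u], [`|W n|] and
    the oscillation of [W] over this interval is at least both [W s - u s] and
    [u (n + 1)]. So its power [2 m], divided by the power [2 m - k] of
    [u (n + 1)], bounds the power [k] of [W s - u s]; [Q] is the sum over [n] of
    such bounds. The exponents balance because [H < 1]: the expectation of the
    power [2 m] grows at most like the power [2 H m] of [n + 1], and
    [2 H m + 2 <= 2 m - k] for large [m]. *)
Lemma fbm_domination (u : R) (k : nat) : 0 < u ->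
  exists Q : Omega -> \bar R,
  [/\ measurable_fun setT Q, forall w, (0 <= Q w)%E, (\int[P]_w Q w < +oo)%E &
    forall w s, 0 <= s -> 0 <= W s w - u * s ->
      (((W s w - u * s) ^+ k)%:E <= Q w)%E].
Proof.
move=> u0; have H1 : 0 < 1 - H by rewrite subr_gt0.
(* large enough for the expectations over unit intervals to be summable *)
pose m := (6 + k + Num.truncn ((k%:R + 2) / (2 * (1 - H)))).+1%N.
have m6 : (6 <= m)%N by rewrite /m; lia.
have km : (k <= 2 * m)%N by rewrite /m; lia.
have mH : 2 * H * m%:R + 2 <= (2 * m - k)%:R.
  have : (k%:R + 2) / (2 * (1 - H)) <= m%:R.
    have z0 : 0 <= (k%:R + 2) / (2 * (1 - H)) :> R.
      by rewrite divr_ge0 ?addr_ge0// mulr_ge0// ltW.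
    have /andP[_ /ltW h] := truncn_itv z0; apply: le_trans h _.
    by rewrite ler_nat /m; lia.
  rewrite ler_pdivrMr; last by rewrite mulr_gt0.
  by rewrite natrB// natrM; nra.
pose M := (2 * m)%N; pose e := (M - k)%N.
pose a (n : nat) : R := 3 ^+ M * (u * n.+1%:R) ^- e.
have a0 n : 0 <= a n.
  by rewrite mulr_ge0 ?exprn_ge0// invr_ge0 exprn_ge0// mulr_ge0// ltW.
pose E n w := dyadic_energy m (fun s => W s w) n.
have E0 n w : (0 <= E n w)%E by exact: dyadic_energy_ge0.
have mE n : measurable_fun setT (E n) by exact: measurable_dyadic_energy.
pose S n w := ((u ^+ M + W n%:R w ^+ M)%:E + (4 ^+ M)%:E * E n w)%E.
have S0 n w : (0 <= S n w)%E.
  rewrite adde_ge0 ?mule_ge0 ?lee_fin ?exprn_ge0//.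
  by rewrite addr_ge0 ?even_ge0.
have mS n : measurable_fun setT (S n).
  apply: emeasurable_funD.
    by apply/measurable_EFinP; apply: measurable_funD => //; exact: measurable_funX.
  exact: emeasurable_funM.
pose Q w := (\sum_(0 <= n <oo) (a n)%:E * S n w)%E.
have aS0 n w : (0 <= (a n)%:E * S n w)%E by rewrite mule_ge0// lee_fin.
exists Q; split.
- by apply: ge0_emeasurable_sum => // n _; exact: emeasurable_funM.
- by move=> w; apply: nneseries_ge0 => n _ _.
- rewrite /Q integral_nneseries//; last by move=> n; exact: emeasurable_funM.
  pose kE := kap m / (1 - 2 * (8 / 9) ^+ m).
  pose c := u ^+ M + kap m + 4 ^+ M * kE.
  have kE0 : 0 <= kE.
    rewrite -lee_fin; apply: le_trans (expectation_dyadic_energy_le 0 m6).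
    by apply: integral_ge0 => w _; exact: E0.
  have uM : 0 <= u ^+ M by rewrite exprn_ge0// ltW.
  have k4 : 0 <= 4 ^+ M * kE by rewrite mulr_ge0// exprn_ge0.
  have c0 : 0 <= c by rewrite /c !addr_ge0.
  have fac0 : 0 <= 3 ^+ M * u ^- e * c.
    by apply: mulr_ge0 => //; rewrite mulr_ge0 ?exprn_ge0// invr_ge0 exprn_ge0// ltW.
  have aS n : (\int[P]_w ((a n)%:E * S n w) <=
      ((3 ^+ M * u ^- e * c) * n.+1%:R ^- 2)%:E)%E.
    rewrite ge0_integralZl//; last by rewrite lee_fin.
    have n1 : 1 <= n.+1%:R :> R by rewrite ler1n.
    pose b := (n.+1%:R `^ (2 * H)) ^+ m : R.
    have b1 : 1 <= b.
      apply: exprn_ege1; apply: (le_trans n1); exact: le1r_powR.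
    have iS : (\int[P]_w S n w <= (c * b)%:E)%E.
      rewrite ge0_integralD//; last 4 first.
      - by move=> w _; rewrite lee_fin addr_ge0 ?even_ge0.
      - by apply/measurable_EFinP; apply: measurable_funD => //; exact: measurable_funX.
      - by move=> w _; rewrite mule_ge0// lee_fin exprn_ge0.
      - exact: emeasurable_funM.
      rewrite ge0_integralZl//.
      under eq_integral do rewrite EFinD.
      rewrite ge0_integralD//; last 2 first.
      - by move=> w _; rewrite lee_fin even_ge0.
      - by apply/measurable_EFinP; exact: measurable_funX.
      have gn := fbm_gaussian H_gt0 W_fBm (ler0n R n).
      rewrite (centred_gaussian_moment m gn) -/(kap m).
      rewrite integral_cst//= probability_setT mule1.
      apply: (@le_trans _ _ (u ^+ M + kap m * b + 4 ^+ M * kE)%:E).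
        rewrite !EFinD; apply: leeD.
          apply: leeD => //; rewrite lee_fin ler_wpM2l//.
          rewrite lerXn2r ?nnegrE ?powR_ge0// ge0_ler_powR ?nnegrE ?ler_nat//.
          by rewrite mulr_ge0// ltW.
        have -> : (4 ^+ M * kE)%:E = ((4 ^+ M)%:E * kE%:E)%E by [].
        apply: lee_wpmul2l; first by rewrite lee_fin exprn_ge0.
        exact: expectation_dyadic_energy_le.
      by rewrite lee_fin /c !mulrDl !lerD// ler_peMr.
    apply: (@le_trans _ _ ((a n)%:E * (c * b)%:E)%E).
      by rewrite lee_wpmul2l// lee_fin.
    rewrite -EFinM lee_fin /a exprMn invfM.
    have assoc (p q r s t : R) : p * (q * r) * (s * t) = p * q * s * (r * t) by ring.
    rewrite assoc.
    rewrite ler_wpM2l//.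
    have ne : 0 < n.+1%:R ^+ e :> R by rewrite exprn_gt0.
    have n2 : 0 < n.+1%:R ^+ 2 :> R by rewrite exprn_gt0.
    rewrite -ler_pdivlMl ?invr_gt0// invrK ler_pdivlMr//.
    rewrite /b -!powR_mulrn ?powR_ge0// -powRrM -powRD ?pnatr_eq0 ?implybT//.
    exact: ler_powR.
  apply: le_lt_trans (lee_nneseries _ (fun n _ => aS n)) _.
    by move=> n _ _; apply: integral_ge0 => w _.
  exact: le_lt_trans (nneseries_inv_sqr_le fac0) (ltry _).
- move=> w s s0 zs0; set z := W s w - u * s.
  pose n := Num.truncn s.
  have /andP[ns sn] : n%:R <= s < n.+1%:R by exact: truncn_itv.
  have un0 : 0 < u * n.+1%:R by rewrite mulr_gt0.
  have cW : continuous (fun t : R => W (Num.max 0 t) w).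
    by have [cw _ _ _ _] := W_fBm; exact: (@continuous_pos_path _ (fun t => W t w) (cw w)).
  apply: (@le_trans _ _ ((a n)%:E * S n w)%E); last first.
    apply: le_trans (nneseries_lim_ge n.+1 _); last by move=> k' _ _; exact: aS0.
    by rewrite big_nat_recr//= leeDr// sume_ge0.
  have m0 : (0 < m)%N by rewrite (leq_trans _ m6).
  have osc := @oscillation_le_energy R m n (fun s => W s w) s m0 cW.
  have {}osc := osc (ltac:(by rewrite ns ltW)).
  set D := W s w - W n%:R w in osc.
  apply: (@le_trans _ _ ((a n)%:E * ((u ^+ M + W n%:R w ^+ M + D ^+ M)%:E))%E); last first.
    rewrite lee_wpmul2l ?lee_fin// /S EFinD leeD2l//.
  rewrite -EFinM lee_fin /a.
  rewrite mulrAC ler_pdivlMr; last by rewrite exprn_gt0.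
  have even_norm (y : R) : y ^+ M = `|y| ^+ M by rewrite -normrX ger0_norm// even_ge0.
  rewrite (even_norm (W _ w)) (even_norm D).
  set A := `|W n%:R w|; set B := `|D|.
  have zu : z <= u + A + B.
    have : z + u * s = W n%:R w + D by rewrite /z /D; ring.
    have := ler_norm (W n%:R w); have := ler_norm D; have := mulr_ge0 (ltW u0) s0.
    rewrite -/A -/B; lra.
  have nu : u * n.+1%:R <= u + A + B.
    have : z + u * s = W n%:R w + D by rewrite /z /D; ring.
    have := ler_norm (W n%:R w); have := ler_norm D.
    have : u * n%:R <= u * s by rewrite ler_pM2l.
    have z0 : 0 <= z by exact: zs0.
    move: z0; rewrite -/A -/B -natr1 mulrDr mulr1; lra.
  have A0 : 0 <= A := normr_ge0 _; have B0 : 0 <= B := normr_ge0 _.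
  have AB0 : 0 <= u + A + B by rewrite !addr_ge0// ltW.
  apply: (@le_trans _ _ ((u + A + B) ^+ M)).
    have -> : M = (k + e)%N by rewrite /M /e subnKC.
    rewrite exprD ler_pM ?exprn_ge0 ?(ltW un0)//.
    + by rewrite lerXn2r.
    + by rewrite lerXn2r// nnegrE ltW.
  (* the largest of the three summands dominates the power of their sum *)
  pose mx := Num.max u (Num.max A B).
  have mx0 : 0 <= mx by rewrite le_max ltW.
  apply: (@le_trans _ _ ((3 * mx) ^+ M)).
    rewrite lerXn2r ?nnegrE ?mulr_ge0//.
    have h1 : u <= mx by rewrite le_max lexx.
    have h2 : A <= mx by rewrite !le_max lexx orbT.
    have h3 : B <= mx by rewrite !le_max lexx !orbT.
    lra.
  rewrite exprMn ler_wpM2l ?exprn_ge0//.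
  have uM : 0 <= u ^+ M by rewrite exprn_ge0// ltW.
  have AM : 0 <= A ^+ M by rewrite exprn_ge0.
  have BM : 0 <= B ^+ M by rewrite exprn_ge0.
  rewrite /mx; case: (leP u _) => _; last by lra.
  by case: (leP A B) => _; lra.
Qed.

End fbm_moments.

(** * Measurability and time reversal *)

Section measurability.
Context d (T : measurableType d) (R : realType).

Lemma measurable_fun_of_le (g : T -> R) :
  (forall c, measurable [set z | g z <= c]) -> measurable_fun setT g.
Proof.
move=> mg; apply: (measurability _ (RGenOInfty.measurableE R)) => //.
move=> _ [_ [c ->] <-]; rewrite setTI.
have -> : g @^-1` `]c, +oo[ = ~` [set z | g z <= c].
  by apply/seteqP; split => z /=; rewrite in_itv/= andbT ltNge => /negP.
exact: measurableC.
Qed.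

Lemma cvg_dyadic_approx (t : R) :
  (Num.truncn (t * 2 ^+ k))%:R / 2 ^+ k @[k --> \oo] --> Num.max 0 t.
Proof.
have p2 (k : nat) : 0 < 2 ^+ k :> R by rewrite exprn_gt0.
have [t0|t0] := leP t 0.
  apply: cvg_near_cst; apply: nearW => k.
  suff -> : Num.truncn (t * 2 ^+ k) = 0%N by rewrite mul0r.
  apply/eqP; rewrite -leqn0 Num.Theory.truncn_le_nat.
  by apply: le_lt_trans (_ : 0 < 1) => //; rewrite mulr_le0_ge0// ltW.
apply: (@squeeze_cvgr _ _ _ _ (fun k => t - (2^-1) ^+ k) (cst t)).
- apply: nearW => k.
  have tk : 0 <= t * 2 ^+ k by rewrite mulr_ge0// ltW.
  have /andP[h1 h2] := truncn_itv tk.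
  rewrite ler_pdivlMr// ler_pdivrMr// h1 andbT mulrBl exprVn mulVf ?gt_eqF//.
  by rewrite lerBlDr natr1 ltW.
- rewrite -[X in _ --> X]subr0; apply: cvgB; first exact: cvg_cst.
  by apply: cvg_expr; rewrite ger0_norm; lra.
- exact: cvg_cst.
Qed.

(** A function measurable in [w] and continuous in [t] is the limit of its
    discretisations along the dyadic times below [t]. *)
Lemma measurable_caratheodory (f : T -> R -> R) :
  (forall t, measurable_fun setT (f ^~ t)) -> (forall w, continuous (f w)) ->
  measurable_fun [set: T * measurableTypeR R]
    (fun z => f z.1 (Num.max 0 (z.2 : R))).
Proof.
move=> mf cf.
pose a (k : nat) (t : R) : R := (Num.truncn (t * 2 ^+ k))%:R / 2 ^+ k.
apply: (@measurable_fun_cvg _ _ _ _ (fun k (z : T * measurableTypeR R) => f z.1 (a k z.2))).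
- move=> k _ A mA; rewrite setTI.
  have -> : (fun z : T * measurableTypeR R => f z.1 (a k z.2)) @^-1` A =
    \bigcup_j (((f ^~ (j%:R / 2 ^+ k)) @^-1` A) `*`
      [set t : measurableTypeR R | Num.truncn ((t : R) * 2 ^+ k) = j]).
    apply/seteqP; split => -[w t] /=.
      by move=> Af; exists (Num.truncn (t * 2 ^+ k)).
    by move=> [j _ [/= Af jE]]; rewrite /a jE.
  apply: bigcupT_measurable => j; apply: measurableX.
    by rewrite -[X in measurable X]setTI; exact: mf.
  apply: is_interval_measurable => x y /= xj yj z /andP[xz zy].
  have p2 : 0 < 2 ^+ k :> R by rewrite exprn_gt0.
  apply/eqP; rewrite eqn_leq; apply/andP; split.
    by rewrite -yj; apply: le_truncn; rewrite ler_pM2r.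
  by rewrite -xj; apply: le_truncn; rewrite ler_pM2r.
- move=> [w t] _ /=.
  apply: (@cvg_comp _ _ _ (a ^~ t) (f w) _ (nbhs (Num.max 0 t))); last exact: cf.
  exact: cvg_dyadic_approx.
Qed.

(** The half lines [`]-oo, c]] are stable under intersection and generate the Borel
    sets. *)
Lemma ge0_integral_eq_cdf (P : probability T R) (X Y : T -> R) (g : R -> \bar R) :
  measurable_fun setT X -> measurable_fun setT Y ->
  (forall c, P [set w | X w <= c] = P [set w | Y w <= c]) ->
  measurable_fun [set: measurableTypeR R] g -> (forall y, 0 <= g y)%E ->
  (\int[P]_w g (X w) = \int[P]_w g (Y w))%E.
Proof.
move=> mX mY XY mg g0.
transitivity (\int[pushforward P (X : T -> measurableTypeR R)]_y g y)%E.
  by rewrite ge0_integral_pushforward; [by []|by []|by []|exact: mg|].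
transitivity (\int[pushforward P (Y : T -> measurableTypeR R)]_y g y)%E; last first.
  by rewrite ge0_integral_pushforward; [by []|by []|by []|exact: mg|].
apply: eq_measure_integral => A mA _.
pose G := [set B : set (measurableTypeR R) | exists c : R, B = `]-oo, c]%classic].
apply: (@g_sigma_algebra_measure_unique _ _ _ G _ (fun n => `]-oo, n%:R]%classic)).
- by move=> _ [c ->]; exact: measurable_itv.
- by move=> n; exists n%:R.
- apply/seteqP; split => // x _; exists (Num.truncn `|x|).+1 => //=.
  by rewrite in_itv/= (le_trans (ler_norm x))// ltW// truncnS_gt.
- move=> _ _ [b ->] [c ->]; exists (Num.min b c).
  by apply/seteqP; split => x /=; rewrite !in_itv/= le_min; [move=> [-> ->]|move/andP].
- by move=> _ [c ->]; rewrite /pushforward; have := XY c; congr (P _ = P _);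
    apply/seteqP; split => w /=; rewrite in_itv.
- move=> k; apply: le_lt_trans (ltry 1); rewrite /pushforward.
  apply: probability_le1.
  by rewrite -[X in measurable X]setTI; apply: mX => //; exact: measurable_itv.
- have : (@RGenOInfty.G R).-sigma.-measurable A by rewrite -RGenOInfty.measurableE.
  apply: smallest_sub; first exact: smallest_sigma_algebra.
  move=> _ [c ->]; rewrite -setCitvl.
  apply: (@measurableC _ (g_sigma_algebraType G)).
  by apply: sub_sigma_algebra; exists c.
Qed.

End measurability.

Section continuous_process.
Context d (Omega : measurableType d) (R : realType) (P : probability Omega R).
Context (W : R -> {RV P >-> R}).
Hypothesis cW : forall w, {within `[0, +oo[, continuous (fun t => W t w)}.

Let joint (b : R) : 0 <= b ->
  measurable_fun [set: Omega * measurableTypeR R]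
    (fun z => W (Num.max 0 (z.2 : R) * b) z.1).
Proof.
move=> b0.
have := @measurable_caratheodory _ _ _ (fun w t => W (Num.max 0 (t * b)) w).
under [X in measurable_fun _ X]eq_fun => z do
  rewrite [Num.max 0 (_ * b)](max_idPr _) ?mulr_ge0 ?le_max ?lexx//.
apply=> [t|w]; first exact: measurable_funP.
have : continuous ((fun t => W (Num.max 0 t) w) \o ( *%R^~ b)).
  move=> t; apply: continuous_comp; last exact: (@continuous_pos_path _ (fun t => W t w) (@cW w)).
  by apply: cvgM; [exact: cvg_id|exact: cvg_cst].
exact.
Qed.

Lemma measurable_reflected_joint x u :
  measurable_fun [set: Omega * measurableTypeR R]
    (fun z => reflected x u (fun s => W s z.1) (Num.max 0 (z.2 : R))).
Proof.
apply: measurable_fun_of_le => c.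
have mt : measurable_fun [set: Omega * measurableTypeR R]
    (fun z => Num.max 0 (z.2 : R)).
  by apply: measurable_maxr => //; exact: measurable_snd.
have mW : measurable_fun [set: Omega * measurableTypeR R]
    (fun z => W (Num.max 0 (z.2 : R)) z.1).
  by have := joint ler01; under eq_fun do rewrite mulr1.
rewrite (_ : [set _ | _] =
  [set z : Omega * measurableTypeR R |
     x - u * Num.max 0 (z.2 : R) + W (Num.max 0 (z.2 : R)) z.1 <= c] `&`
  \bigcap_k [set z : Omega * measurableTypeR R |
     W (Num.max 0 (z.2 : R)) z.1 - W (Num.max 0 (z.2 : R) * unit_rat k) z.1 <=
     c + u * (Num.max 0 (z.2 : R) - Num.max 0 (z.2 : R) * unit_rat k)]); last first.
  apply/seteqP; split => -[w t] /=;
    rewrite (reflected_leP _ _ (_ : 0 <= Num.max 0 t) (@cW w)) ?le_max ?lexx//.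
    by move=> [h1 h2]; split => // k _; exact: h2.
  by move=> [h1 h2]; split => // k; exact: h2.
apply: measurableI.
  rewrite -[X in measurable X]setTI; apply: measurable_fun_ler => //.
  by apply: measurable_funD => //; apply: measurable_funB => //; exact: measurable_funM.
apply: bigcapT_measurable => k; have /andP[q0 q1] := @unit_rat_itv R k.
rewrite -[X in measurable X]setTI; apply: measurable_fun_ler => //.
  by apply: measurable_funB => //; exact: joint.
apply: measurable_funD => //; apply: measurable_funM => //.
by apply: measurable_funB => //; exact: measurable_funM.
Qed.

Lemma measurable_reflected x u t : 0 <= t ->
  measurable_fun setT (fun w => reflected x u (fun s => W s w) t).
Proof.
move=> t0; have := measurable_fun_pair1 (t : measurableTypeR R) (measurable_reflected_joint x u).
by under eq_fun do rewrite /= (max_idPr t0).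
Qed.

Lemma measurable_forward_content x u t : 0 <= t ->
  measurable_fun setT (fun w => forward_content x u t (fun s => W s w)).
Proof.
move=> t0; apply: measurable_fun_of_le => c.
rewrite (_ : [set _ | _] = [set w | x - u * t + W t w <= c] `&`
  \bigcap_k [set w | W (t - t * unit_rat k) w <= c + u * (t - t * unit_rat k)]); last first.
  apply/seteqP; split => w /=; rewrite (forward_content_leP _ _ t0 (@cW w)).
    by move=> [h1 h2]; split => // k _; exact: h2.
  by move=> [h1 h2]; split => // k; exact: h2.
apply: measurableI.
  by rewrite -[X in measurable X]setTI; apply: measurable_fun_ler => //; exact: measurable_funD.
apply: bigcapT_measurable => k.
by rewrite -[X in measurable X]setTI; exact: measurable_fun_ler.
Qed.

(** The path being continuous, rational times give the same supremum. *)
Lemma measurable_max_workload u :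
  measurable_fun setT (fun w => max_workload u (fun s => W s w)).
Proof.
pose q (k : nat) : R := Num.max 0 (if unpickle k is Some r then ratr r else 0).
have q0 k : 0 <= q k by rewrite le_max lexx.
have -> : (fun w => max_workload u (fun s => W s w)) =
    (fun w => esups (fun k => (W (q k) w - u * q k)%:E) 0%N).
  apply/funext => w; apply/eqP; rewrite eq_le; apply/andP; split; last first.
    apply: ge_ereal_sup => _ [k _ <-]; apply: ereal_sup_ubound.
    by exists (q k) => //=; rewrite in_itv/= andbT.
  apply: ge_ereal_sup => _ [s /= s0 <-]; rewrite in_itv/= andbT in s0.
  set S := esups _ _.
  have leS k : ((W (q k) w - u * q k)%:E <= S)%E by apply: ereal_sup_ubound; exists k.
  move: leS; case: S => [c| |] leS; last 2 first.
  - by rewrite leey.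
  - by have := leS 0%N; rewrite leeNy_eq.
  rewrite lee_fin -(max_idPr s0).
  apply: (@ratr_dense_le _ (fun s => W (Num.max 0 s) w - u * Num.max 0 s)).
    move=> z; apply: cvgB; first exact: (@continuous_pos_path _ (fun t => W t w) (@cW w)).
    by apply: cvgM; [exact: cvg_cst|exact: continuous_max0].
  by move=> r; have := leS (pickle r); rewrite lee_fin /q pickleK.
apply: measurable_fun_esups => k; apply/measurable_EFinP.
exact: measurable_funB.
Qed.

End continuous_process.

(** The events that the two contents are at most [c] are countable families of
    inequalities on the path, which time reversal exchanges; the one about the
    initial content [x] corresponds to the increment since time [0]. *)
Lemma reflected_forward_law d (Omega : measurableType d) (R : realType)
    (P : probability Omega R) (H : R) (W : R -> {RV P >-> R}) (x u t : R)
    (g : R -> \bar R) :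
  0 < H -> is_fBm P H W -> 0 <= t ->
  measurable_fun [set: measurableTypeR R] g -> (forall y, 0 <= g y)%E ->
  (\int[P]_w g (reflected x u (fun s => W s w) t) =
   \int[P]_w g (forward_content x u t (fun s => W s w)))%E.
Proof.
move=> H0 WH t0 mg g0; have [cW _ _ W0 _] := WH.
apply: ge0_integral_eq_cdf => //.
- exact: measurable_reflected.
- exact: measurable_forward_content.
move=> c.
(* index [0] is for the path started from [x] at time [0] *)
pose s (k : nat) := if k is k'.+1 then t * unit_rat k' else 0 : R.
pose b (k : nat) := if k is k'.+1 then c + u * (t - t * unit_rat k') else c - x + u * t.
have st k : 0 <= s k <= t.
  case: k => [|k] /=; first by rewrite lexx.
  by have /andP[q0 q1] := @unit_rat_itv R k; rewrite mulr_ge0// ler_piMr.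
have := @fbm_reversal_prob _ _ _ P H W t s b H0 WH t0 st.
congr (P _ = P _).
- apply/seteqP; split => w /=; rewrite (reflected_leP _ _ t0 (cW w)).
    move=> h; split; first by have := h 0%N; rewrite /= W0; lra.
    by move=> k; exact: (h k.+1).
  by move=> [h1 h2] [|k] /=; [rewrite W0; lra|exact: h2].
- apply/seteqP; split => w /=; rewrite (forward_content_leP _ _ t0 (cW w)).
    move=> h; split; first by have := h 0%N; rewrite /= subr0; lra.
    by move=> k; exact: (h k.+1).
  by move=> [h1 h2] [|k] /=; [rewrite subr0; lra|exact: h2].
Qed.

(** * The maximal workload of a path *)

Section workload.
Context {R : realType} (w : R -> R).
Hypothesis w0 : w 0 = 0.
Implicit Types (u a b c x t : R).

Let Z u := max_workload u w.
Let z u : R := fine (Z u).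

Lemma max_workload_leP u (c : \bar R) : (Z u <= c)%E <->
  forall s, 0 <= s -> ((w s - u * s)%:E <= c)%E.
Proof.
split=> [Zc s s0|h].
  apply: le_trans Zc; apply: ereal_sup_ubound.
  by exists s => //=; rewrite in_itv/= andbT.
by apply: ge_ereal_sup => _ [s /= s0 <-]; apply: h; rewrite in_itv/= andbT in s0.
Qed.

Lemma max_workload_ge0 u : (0 <= Z u)%E.
Proof.
have /max_workload_leP/(_ 0 (lexx _)) := lexx (Z u).
by rewrite w0 mulr0 subr0.
Qed.

Lemma fine_workload_ge0 u : 0 <= z u.
Proof. exact/fine_ge0/max_workload_ge0. Qed.

Lemma max_workload_nincr a u : a <= u -> (Z u <= Z a)%E.
Proof.
move=> au; apply/max_workload_leP => s s0.
have /max_workload_leP/(_ s s0) := lexx (Z a); apply: le_trans.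
by rewrite lee_fin lerD2l lerN2 ler_wpM2r.
Qed.

Lemma max_workload_fin_num a u : a <= u -> Z a \is a fin_num -> Z u \is a fin_num.
Proof.
move=> au; rewrite !ge0_fin_numE ?max_workload_ge0//.
exact/le_lt_trans/max_workload_nincr.
Qed.

Lemma fine_workload_leP u c : Z u \is a fin_num ->
  z u <= c <-> forall s, 0 <= s -> w s - u * s <= c.
Proof. by move=> Zfin; rewrite -lee_fin fineK// max_workload_leP. Qed.

Lemma le_fine_workload u s : Z u \is a fin_num -> 0 <= s -> w s - u * s <= z u.
Proof. by move=> Zfin; have [+ _] := fine_workload_leP (z u) Zfin; apply. Qed.

Lemma fine_workload_nincr a u : a <= u -> Z a \is a fin_num -> z u <= z a.
Proof.
by move=> au fa; rewrite fine_le ?max_workload_nincr// (max_workload_fin_num au).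
Qed.

(** As a supremum of affine functions of the rate, the maximal workload is convex. *)
Lemma fine_workload_convex a b t : 0 <= t <= 1 ->
  Z a \is a fin_num -> Z b \is a fin_num ->
  z (t * a + (1 - t) * b) <= t * z a + (1 - t) * z b.
Proof.
move=> /andP[t0 t1] fa fb; have t1' : 0 <= 1 - t by rewrite subr_ge0.
have fab : Z (t * a + (1 - t) * b) \is a fin_num.
  apply: (@max_workload_fin_num (Num.min a b)); last by rewrite /Num.min; case: ifP.
  set m := Num.min a b; rewrite (_ : m = t * m + (1 - t) * m); last by ring.
  by rewrite lerD// ler_wpM2l// ge_min lexx ?orbT.
apply/(fine_workload_leP _ fab) => s s0.
rewrite (_ : _ - _ = t * (w s - a * s) + (1 - t) * (w s - b * s)); last by ring.
by rewrite lerD// ler_wpM2l//; exact: le_fine_workload.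
Qed.

(** Convexity and monotonicity give a local Lipschitz bound. *)
Lemma fine_workload_lipschitz a u v : a < u -> u <= v -> Z a \is a fin_num ->
  `|z u - z v| <= (v - u) / (u - a) * z a.
Proof.
move=> au uv fa; have ua0 : 0 < u - a by rewrite subr_gt0.
have va0 : 0 < v - a by rewrite subr_gt0 (lt_le_trans au).
have fv : Z v \is a fin_num by apply: max_workload_fin_num fa; rewrite ltW// (lt_le_trans au).
have fu : Z u \is a fin_num by apply: max_workload_fin_num fa; rewrite ltW.
rewrite ger0_norm ?subr_ge0 ?fine_workload_nincr//.
pose t := (v - u) / (v - a).
have t01 : 0 <= t <= 1.
  apply/andP; split; first by rewrite divr_ge0 ?subr_ge0// ltW// (lt_le_trans au).
  by rewrite /t ler_pdivrMr// mul1r lerB// ltW.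
have := fine_workload_convex t01 fa fv.
have -> : t * a + (1 - t) * v = u by rewrite /t; field; rewrite gt_eqF.
have t_le : t <= (v - u) / (u - a).
  by rewrite /t ler_wpM2l ?subr_ge0// lef_pV2 ?posrE// lerB.
have tv : 0 <= t * z v by rewrite mulr_ge0 ?fine_workload_ge0//; case/andP: t01.
have : t * z a <= (v - u) / (u - a) * z a by rewrite ler_wpM2r// fine_workload_ge0.
lra.
Qed.

Lemma fine_workload_continuous a v : a < v -> Z a \is a fin_num ->
  {for v, continuous z}.
Proof.
move=> av fa; pose m := (a + v) / 2.
have am : a < m by rewrite /m; lra.
have mv : m < v by rewrite /m; lra.
pose L := z a / (m - a).
have ma0 : 0 < m - a by rewrite subr_gt0.
have L0 : 0 <= L by rewrite divr_ge0 ?fine_workload_ge0// ltW.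
have lip x y : m <= x -> x <= y -> `|z x - z y| <= L * (y - x).
  move=> mx xy; have ax : a < x by exact: lt_le_trans mx.
  apply: le_trans (fine_workload_lipschitz ax xy fa) _.
  rewrite /L mulrAC -mulrA mulrC ler_wpM2r ?subr_ge0//.
  rewrite ler_wpM2l ?fine_workload_ge0// lef_pV2 ?posrE ?subr_gt0// lerB//.
apply/cvgrPdist_le => /= e e0; near=> u.
have mu : m <= u by near: u; exact: (cvgr_ge v).
have uv : `|v - u| <= e / (L + 1).
  near: u; apply: cvgr_dist_le; first exact: cvg_id.
  by rewrite divr_gt0// ltr_wpDl.
have eL : L * `|v - u| <= e.
  apply: (@le_trans _ _ (L * (e / (L + 1)))); first by rewrite ler_wpM2l.
  rewrite mulrCA ger_pMr// ler_pdivrMr ?mul1r ?ltr_wpDl//; lra.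
have [uv'|vu] := leP u v.
  by rewrite distrC; apply: le_trans (lip _ _ mu uv') _; rewrite -[v - u]ger0_norm// subr_ge0.
apply: le_trans (lip _ _ (ltW mv) (ltW vu)) _.
by rewrite -[u - v]ger0_norm ?subr_ge0 ?(ltW vu)// distrC.
Unshelve. all: by end_near. Qed.

Section forward_limit.
Hypothesis cw : {within `[0, +oo[, continuous w}.

Lemma forward_content_le x u t : 0 <= x -> 0 <= t -> Z u \is a fin_num ->
  forward_content x u t w <= x + z u.
Proof.
move=> x0 t0 fu; rewrite /forward_content ge_max; apply/andP; split.
  by have := le_fine_workload fu t0; lra.
apply/(running_sup_leP u t0 cw) => s /andP[s0 _].
by have := le_fine_workload fu s0; lra.
Qed.

(** For a rate [a < u] of finite workload, [W t - a t] is bounded above, so that the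
    term [x - u t + W t] of the initial content becomes negative. *)
Lemma cvg_forward_content x u a : a < u -> Z a \is a fin_num ->
  forward_content x u t w @[t --> +oo] --> z u.
Proof.
move=> au fa; have fu := max_workload_fin_num (ltW au) fa.
apply/cvgrPdist_le => /= e e0.
have [s s0 zs] : exists2 s, 0 <= s & z u - e < w s - u * s.
  apply: contrapT => h.
  have : z u <= z u - e.
    apply/(fine_workload_leP _ fu) => s s0; rewrite leNgt; apply/negP => hs.
    by apply: h; exists s.
  lra.
near=> t.
have t0 : 0 <= t by near: t; apply: nbhs_pinfty_ge; exact: num_real.
have st : s <= t by near: t; apply: nbhs_pinfty_ge; exact: num_real.
have xt : (x + z a) / (u - a) <= t by near: t; apply: nbhs_pinfty_ge; exact: num_real.
have hup : forward_content x u t w <= z u.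
  rewrite /forward_content ge_max; apply/andP; split.
    apply: le_trans (fine_workload_ge0 u).
    rewrite ler_pdivrMr ?subr_gt0// in xt.
    by have := le_fine_workload fa t0; lra.
  by apply/(running_sup_leP u t0 cw) => r /andP[r0 _]; exact: le_fine_workload.
have hlo : w s - u * s <= forward_content x u t w.
  rewrite /forward_content le_max; apply/orP; right.
  have /(running_sup_leP u t0 cw)/(_ s) := lexx (sup [set w s - u * s | s in `[0, t]]).
  by rewrite s0 st; apply.
rewrite ger0_norm ?subr_ge0//; lra.
Unshelve. all: by end_near. Qed.

End forward_limit.

End workload.

(** * Long-run averages *)

Section cesaro.
Context {R : realType}.
Local Notation mu := (@lebesgue_measure R).

Lemma limf_esup_pinfty (g : R -> \bar R) (l : R) :
  (forall e, 0 < e -> \forall T \near +oo, ((l - e)%:E <= g T <= (l + e)%:E)%E) ->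
  limf_esup g +oo_R = l%:E.
Proof.
move=> gl; apply/eqP; rewrite eq_le; apply/andP; split.
  apply/lee_addgt0Pr => e e0; rewrite -EFinD.
  apply: (@le_trans _ _ (ereal_sup (g @` [set T | (g T <= (l + e)%:E)%E]))).
    apply: ereal_inf_lbound; exists [set T | (g T <= (l + e)%:E)%E] => //.
    by apply: filterS (gl e e0) => T /andP[].
  by apply: ge_ereal_sup => _ [T + <-].
apply: le_ereal_inf_tmp => _ [V FV <-].
apply/lee_addgt0Pr => e e0.
have [T [VT /andP[+ _]]] := filter_ex (filterI FV (gl e e0)).
rewrite EFinB leeBlDr// => /le_trans; apply.
by rewrite leeD2r//; apply: ereal_sup_ubound; exists T.
Qed.

Lemma cesaro_limf_esup (f : R -> R) (l M : R) : measurable_fun setT f ->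
  (forall t, 0 <= f t <= M) -> f t @[t --> +oo] --> l ->
  limf_esup (fun T : R => (T^-1)%:E * \int[mu]_(t in `[0%R, T]) (f t)%:E)%E +oo_R = l%:E.
Proof.
move=> mf fM fl.
have f0 t : 0 <= f t by have /andP[] := fM t.
have M0 : 0 <= M by have /andP[h1 h2] := fM 0; exact: le_trans h2.
have l0 : 0 <= l.
  by apply: (ler_cvg_to (cvg_cst 0) fl); apply: nearW.
have lM : l <= M.
  by apply: (ler_cvg_to fl (cvg_cst M)); apply: nearW => t; have /andP[] := fM t.
apply: limf_esup_pinfty => e e0; have e20 : 0 < e / 2 by rewrite divr_gt0.
have [A [_ fA]] : \forall t \near +oo, `|l - f t| <= e / 2.
  by move/cvgrPdist_le : fl; exact.
pose B := Num.max A 0; have B0 : 0 <= B by rewrite le_max lexx orbT.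
have fB t : B < t -> `|l - f t| <= e / 2.
  by move=> Bt; apply: fA; apply: le_lt_trans Bt; rewrite le_max lexx.
near=> T.
have T0 : 0 < T by near: T; apply: nbhs_pinfty_gt; exact: num_real.
have TB : B <= T by near: T; apply: nbhs_pinfty_ge; exact: num_real.
have TMB : M * B / (e / 2) <= T by near: T; apply: nbhs_pinfty_ge; exact: num_real.
have MBT : M * B <= e / 2 * T by rewrite [leRHS]mulrC -ler_pdivrMr.
have cstI (c : R) : (\int[mu]_(t in `[0%R, T]) c%:E = (c * T)%:E)%E.
  by rewrite integral_cst//= lebesgue_measure_itv/= lte_fin T0 -EFinB subr0 -EFinM.
(* up to time [B] the integrand is only known to be between [0] and [M]; this
   costs [M * B], which is small compared with [T] *)
have indI : (\int[mu]_(t in `[0%R, T]) (M * \1_(`[0, B]%classic) t)%:E <= (M * B)%:E)%E.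
  under eq_integral do rewrite EFinM.
  rewrite ge0_integralZl//; last first.
    by apply/measurable_EFinP; apply: measurable_funTS; exact: measurable_indic.
  rewrite integral_indic// EFinM lee_wpmul2l// ?lee_fin//.
  apply: (@le_trans _ _ (mu `[0, B])).
    by apply: le_measure; rewrite ?inE//; exact: measurableI.
  rewrite lebesgue_measure_itv/= lte_fin; case: ifPn => _; last by rewrite lee_fin.
  by rewrite -EFinB subr0.
have mT : measurable_fun `[0, T]%classic (EFin \o f).
  by apply/measurable_EFinP; exact: measurable_funTS.
have mI : measurable_fun `[0, T]%classic (fun t => (M * \1_(`[0, B]%classic) t)%:E).
  by apply/measurable_EFinP; apply: measurable_funTS; apply: measurable_funM => //; exact: measurable_indic.
have indB t : B < t \/ \1_(`[0, B]%classic) t = 1 :> R \/ t < 0.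
  have [|tB] := ltP B t; [by left|right].
  have [t0|] := leP 0 t; [left|by right].
  by rewrite indicE mem_set//= in_itv/= t0.
have up : (\int[mu]_(t in `[0%R, T]) (f t)%:E <= ((l + e / 2) * T + M * B)%:E)%E.
  rewrite EFinD -cstI; apply: le_trans (leeD (lexx _) indI).
  rewrite -ge0_integralD//; last 2 first.
  - by move=> t _; rewrite lee_fin addr_ge0// ltW.
  - by move=> t _; rewrite lee_fin mulr_ge0.
  apply: ge0_le_integral => //.
  - by move=> t _; rewrite lee_fin.
  - exact: emeasurable_funD.
  - move=> t /=; rewrite in_itv/= => /andP[t0 tT]; rewrite -EFinD lee_fin.
    have i0 : 0 <= M * \1_(`[0, B]%classic) t by rewrite mulr_ge0.
    have [/fB|[->|]] := indB t; last by rewrite ltNge t0.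
    + by rewrite ler_norml => /andP[]; lra.
    + by rewrite mulr1; have /andP[] := fM t; lra.
have lo : ((l * T)%:E <= \int[mu]_(t in `[0%R, T]) (f t)%:E + (e / 2 * T + M * B)%:E)%E.
  rewrite -cstI EFinD -cstI addeA; apply: le_trans (leeD (lexx _) indI).
  rewrite -ge0_integralD//; last 2 first.
  - by move=> t _; rewrite lee_fin.
  - by move=> t _; rewrite lee_fin ltW.
  rewrite -ge0_integralD//; last 3 first.
  - by move=> t _; rewrite -EFinD lee_fin addr_ge0// ltW.
  - exact: emeasurable_funD.
  - by move=> t _; rewrite lee_fin mulr_ge0.
  apply: ge0_le_integral => //.
  - by apply: emeasurable_funD => //; exact: emeasurable_funD.
  - move=> t /=; rewrite in_itv/= => /andP[t0 tT]; rewrite -!EFinD lee_fin.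
    have i0 : 0 <= M * \1_(`[0, B]%classic) t by rewrite mulr_ge0.
    have [/fB|[->|]] := indB t; last by rewrite ltNge t0.
    + by rewrite ler_norml => /andP[]; lra.
    + by rewrite mulr1; have := f0 t; lra.
have Ifin : (\int[mu]_(t in `[0%R, T]) (f t)%:E)%E \is a fin_num.
  rewrite ge0_fin_numE; first exact: le_lt_trans up (ltry _).
  by apply: integral_ge0 => t _; rewrite lee_fin.
move: up lo; rewrite -(fineK Ifin) -EFinD -EFinM !lee_fin => up lo.
move: (fine _) up lo => I up lo.
by apply/andP; split; rewrite mulrC ?ler_pdivlMr ?ler_pdivrMr//; lra.
Unshelve. all: by end_near. Qed.

End cesaro.

(** * Cost functions *)

Section pos_ext.
Context {R : realType}.
Variable C : R -> R.

(** A cost is only constrained on the half line; this extends it to a continuous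
    and monotone function on the whole line. *)
Definition pos_ext (y : R) := C (Num.max 0 y).

Lemma pos_extE y : 0 <= y -> pos_ext y = C y.
Proof. by move=> y0; rewrite /pos_ext max_r. Qed.

Lemma pos_ext_ge0 y : (forall y, 0 <= y -> 0 <= C y) -> 0 <= pos_ext y.
Proof. by move=> C0; apply: C0; rewrite le_max lexx. Qed.

Lemma pos_ext_le y z : {in `[0, +oo[ &, {homo C : y z / y <= z}} ->
  y <= z -> pos_ext y <= pos_ext z.
Proof.
move=> Ch yz; have m0 t : Num.max 0 t \in `[(0 : R), +oo[.
  by rewrite in_itv/= andbT le_max lexx.
by apply: Ch => //; rewrite ge_max !le_max lexx yz orbT.
Qed.

Lemma measurable_pos_ext d (T : measurableType d) (f : T -> R) :
  {within `[0, +oo[, continuous C} -> measurable_fun setT f ->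
  measurable_fun setT (pos_ext \o f).
Proof.
move=> cC mf; apply: measurableT_comp => //.
by apply: continuous_measurable_fun; exact: continuous_pos_path.
Qed.

Lemma polynomial_growth (K gamma x : R) : 0 < K -> 0 < gamma ->
  (forall y, 0 <= y -> C y <= K * (1 + y `^ gamma)) -> 0 <= x ->
  exists a b k, [/\ (0 < k)%N, 0 <= a, 0 <= b &
    forall y, 0 <= y -> C (x + y) <= a + b * y ^+ k].
Proof.
move=> K0 g0 CK x0; pose k := (Num.truncn gamma).+1.
have gk : gamma <= k%:R.
  have /andP[_ /ltW] : (Num.truncn gamma)%:R <= gamma < (Num.truncn gamma).+1%:R.
    by apply: truncn_itv; exact: ltW.
  by [].
exists (K * (1 + 2 ^+ k * (1 + x) ^+ k)), (K * 2 ^+ k), k.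
have e1 : 0 <= (1 + x) ^+ k by rewrite exprn_ge0// addr_ge0.
have e2 : 0 <= 2 ^+ k :> R by rewrite exprn_ge0.
have K0' := ltW K0.
split => //.
- by rewrite mulr_ge0// addr_ge0// mulr_ge0.
- by rewrite mulr_ge0.
move=> y y0; apply: le_trans (CK _ _) _; first by rewrite addr_ge0.
rewrite -mulrA -mulrDr ler_pM2l// -addrA lerD2l -mulrDr.
have yk : 0 <= y ^+ k by rewrite exprn_ge0.
have xy1 : 1 <= 1 + x + y by rewrite -addrA lerDl addr_ge0.
apply: (@le_trans _ _ ((1 + x + y) ^+ k)).
  apply: (@le_trans _ _ ((1 + x + y) `^ gamma)).
    by apply: ge0_ler_powR; rewrite ?nnegrE ?addr_ge0// ?ltW// -addrA ltrDr.
  by rewrite -powR_mulrn ?(le_trans _ xy1)// ler_powR.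
have [yx|xy] := leP y (1 + x).
  apply: (@le_trans _ _ ((2 * (1 + x)) ^+ k)).
    by rewrite lerXn2r ?nnegrE ?mulr_ge0 ?addr_ge0//; lra.
  by rewrite exprMn ler_wpM2l// lerDl.
apply: (@le_trans _ _ ((2 * y) ^+ k)).
  by rewrite lerXn2r ?nnegrE ?mulr_ge0 ?addr_ge0//; lra.
by rewrite exprMn ler_wpM2l// lerDr.
Qed.

End pos_ext.

(** * Integrability of the stationary cost *)

Section stationary.
Context d (Omega : measurableType d) (R : realType) (P : probability Omega R).
Context (H : R) (W : R -> {RV P >-> R}) (C : R -> R) (K gamma : R).
Hypothesis H_ge : 2^-1 <= H.
Hypothesis H_lt : H < 1.
Hypothesis W_fBm : is_fBm P H W.
Hypothesis C_ge0 : forall y, 0 <= y -> 0 <= C y.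
Hypothesis C_cont : {within `[0, +oo[, continuous C}.
Hypothesis C_nondecr : {in `[0, +oo[ &, {homo C : y z / y <= z}}.
Hypothesis K_gt0 : 0 < K.
Hypothesis gamma_gt0 : 0 < gamma.
Hypothesis C_growth : forall y, 0 <= y -> C y <= K * (1 + y `^ gamma).

Let H_gt0 : 0 < H. Proof. by apply: lt_le_trans H_ge; rewrite invr_gt0. Qed.

Let cW w : {within `[0, +oo[, continuous (fun t => W t w)}.
Proof. by have [cw _ _ _ _] := W_fBm; exact: cw. Qed.

Let W0 w : W 0 w = 0.
Proof. by have [_ _ _ w0 _] := W_fBm; exact: w0. Qed.

Let Z u w := max_workload u (fun s => W s w).

(** The workload decreases with the rate, so that the countably many rates
    [1 / (n + 1)] decide all the others. *)
Lemma ae_max_workload_fin_num :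
  {ae P, forall w, forall u, 0 < u -> Z u w \is a fin_num}.
Proof.
have fin n : {ae P, forall w, Z n.+1%:R^-1 w \is a fin_num}.
  have [|Q [mQ Q0 iQ WQ]] := fbm_domination H_ge H_lt W_fBm (u := n.+1%:R^-1) 1.
    by rewrite invr_gt0.
  have intQ : P.-integrable setT Q.
    by apply/integrableP; split => //; under eq_integral do rewrite gee0_abs//.
  apply: filterS (integrable_ae measurableT intQ) => w /(_ I) Qw.
  rewrite ge0_fin_numE ?max_workload_ge0//.
  apply: (@le_lt_trans _ _ (Q w)); last by rewrite -ge0_fin_numE.
  apply/max_workload_leP => s s0.
  have [zs|zs] := leP 0 (W s w - n.+1%:R^-1 * s).
    by rewrite -[_ - _]expr1; exact: WQ.
  by apply: le_trans (Q0 w); rewrite lee_fin ltW.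
have /negligible_bigcup : forall n, P.-negligible (~` [set w | Z n.+1%:R^-1 w \is a fin_num]).
  by move=> n; exact: fin.
apply: negligibleS => w /= nZ; apply: contrapT => /= nbig.
apply: nZ => u u0.
pose n := Num.truncn u^-1.
have nu : n.+1%:R^-1 <= u.
  have /andP[_ /ltW] : n%:R <= u^-1 < n.+1%:R.
    by apply: truncn_itv; rewrite invr_ge0 ltW.
  by move=> un; rewrite -[u]invrK lef_pV2// posrE ?invr_gt0.
apply: (max_workload_fin_num _ nu) => //.
by apply: contrapT => nfin; apply: nbig; exists n.
Qed.

Lemma measurable_fine_workload u : measurable_fun setT (fun w => fine (Z u w)).
Proof.
apply: (measurableT_comp (fine_measurable measurableT)).
exact: measurable_max_workload.
Qed.

Let zge0 u w : 0 <= fine (Z u w).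
Proof. exact: fine_workload_ge0. Qed.

(** [fine] sends an infinite workload to [0], which is why the moment bound on
    the workload holds at every [w]. *)
Lemma integrable_cost u x : 0 < u -> 0 <= x ->
  P.-integrable setT (fun w => (C (x + fine (Z u w)))%:E).
Proof.
move=> u0 x0.
have [a [b [k [k0 a0 b0 Cab]]]] := polynomial_growth K_gt0 gamma_gt0 C_growth x0.
have [Q [mQ Q0 iQ WQ]] := fbm_domination H_ge H_lt W_fBm k u0.
have zQ w : ((fine (Z u w) ^+ k)%:E <= Q w)%E.
  have [fz|nz] := boolP (Z u w \is a fin_num); last first.
    suff -> : fine (Z u w) = 0 by rewrite expr0n gtn_eqF.
    by move: nz; case: (Z u w).
  have [fQ|] := boolP (Q w \is a fin_num); last first.
    by rewrite ge0_fin_numE// -leNgt leye_eq => /eqP ->; rewrite leey.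
  have [|A A0 Ak] := nth_root_exists k0 (b := fine (Q w)).
    by rewrite fine_ge0.
  rewrite -(fineK fQ) lee_fin -Ak lerXn2r ?nnegrE//.
  apply/(fine_workload_leP _ fz) => s s0.
  have [zs|/ltW zs] := leP 0 (W s w - u * s); last exact: le_trans A0.
  by rewrite -(ler_pXn2r k0)// Ak -lee_fin fineK//; exact: WQ.
have mC : measurable_fun setT (fun w => (C (x + fine (Z u w)))%:E).
  apply/measurable_EFinP.
  apply: (eq_measurable_fun (pos_ext C \o (fun w => x + fine (Z u w)))).
    by move=> w _ /=; rewrite pos_extE// addr_ge0.
  apply: measurable_pos_ext => //; apply: measurable_funD => //.
  exact: measurable_fine_workload.
apply/integrableP; split => //.
have bound w : (`|(C (x + fine (Z u w)))%:E| <= a%:E + b%:E * Q w)%E.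
  rewrite gee0_abs ?lee_fin ?C_ge0 ?addr_ge0//.
  apply: (@le_trans _ _ (a + b * fine (Z u w) ^+ k)%:E).
    by rewrite lee_fin; exact: Cab.
  by rewrite EFinD EFinM leeD2l// lee_wpmul2l.
have mbQ : measurable_fun setT (fun w => b%:E * Q w)%E.
  exact: measurable_funeM.
apply: (@le_lt_trans _ _ (\int[P]_w (a%:E + b%:E * Q w))%E).
  apply: ge0_le_integral => //.
  - exact: measurableT_comp.
  - exact: emeasurable_funD.
rewrite ge0_integralD//; last first.
  by move=> w _; rewrite mule_ge0.
rewrite integral_cst//= ge0_integralZl//.
rewrite probability_setT mule1 lte_add_pinfty ?ltry//.
have fI : (\int[P]_w Q w)%E \is a fin_num.
  by rewrite ge0_fin_numE//; apply: integral_ge0 => w _; exact: Q0.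
by rewrite -(fineK fI) -EFinM ltry.
Qed.

Let mu := @lebesgue_measure R.

Let G u := \int[P]_w C (fine (Z u w)).

Lemma integrable_stationary u : 0 < u ->
  P.-integrable setT (fun w => (C (fine (Z u w)))%:E).
Proof.
move=> u0; have := integrable_cost u0 (lexx 0).
by under eq_fun do rewrite add0r.
Qed.

Lemma stationary_cost_integral u : 0 < u ->
  (G u)%:E = (\int[P]_w (C (fine (Z u w)))%:E)%E.
Proof.
move=> u0; rewrite /G /Rintegral fineK//.
exact: integrable_fin_num (integrable_stationary u0).
Qed.

Lemma stationary_costE u : 0 < u -> stationary_cost P W C u = (G u)%:E.
Proof. by move=> u0; rewrite /stationary_cost unlock stationary_cost_integral. Qed.

(** * The mean cost at a fixed time *)

Let F x u t := (\int[P]_w (C (reflected x u (fun s => W s w) t))%:E)%E.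

Lemma mean_costE x u t : 0 <= t ->
  F x u t = (\int[P]_w (pos_ext C (forward_content x u t (fun s => W s w)))%:E)%E.
Proof.
move=> t0; rewrite /F.
transitivity (\int[P]_w (pos_ext C (reflected x u (fun s => W s w) t))%:E)%E.
  by apply: eq_integral => w _; rewrite pos_extE//; exact: reflected_ge0.
apply: (@reflected_forward_law _ _ _ _ H W x u t (EFin \o pos_ext C)) => //.
- by apply/measurable_EFinP; apply: (measurable_pos_ext (f := id)).
- by move=> y; rewrite lee_fin pos_ext_ge0.
Qed.

Lemma ae_forward_cost_le u x t : 0 < u -> 0 <= x -> 0 <= t ->
  {ae P, forall w, pos_ext C (forward_content x u t (fun s => W s w)) <=
                   C (x + fine (Z u w))}.
Proof.
move=> u0 x0 t0; apply: filterS ae_max_workload_fin_num => w /(_ _ u0) fz.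
rewrite -[leRHS]pos_extE ?addr_ge0//; apply: pos_ext_le => //.
exact: forward_content_le.
Qed.

Lemma measurable_forward_cost x u t : 0 <= t ->
  measurable_fun setT
    (fun w => (pos_ext C (forward_content x u t (fun s => W s w)))%:E).
Proof.
move=> t0; apply/measurable_EFinP.
by apply: (measurable_pos_ext C_cont); exact: measurable_forward_content.
Qed.

Lemma mean_cost_le u x t : 0 < u -> 0 <= x -> 0 <= t ->
  (F x u t <= \int[P]_w (C (x + fine (Z u w)))%:E)%E.
Proof.
move=> u0 x0 t0; rewrite mean_costE//; apply: ae_ge0_le_integral => //.
- by move=> w _; rewrite lee_fin pos_ext_ge0.
- exact: measurable_forward_cost.
- by move=> w _; rewrite lee_fin C_ge0// addr_ge0.
- by have /integrableP[] := integrable_cost u0 x0.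
- by apply: filterS (ae_forward_cost_le u0 x0 t0) => w h _; rewrite lee_fin.
Qed.

Lemma mean_cost_fin_num u x t : 0 < u -> 0 <= x -> 0 <= t ->
  F x u t \is a fin_num.
Proof.
move=> u0 x0 t0; rewrite ge0_fin_numE.
  apply: le_lt_trans (mean_cost_le u0 x0 t0) _.
  have /integrableP[_] := integrable_cost u0 x0.
  under eq_integral do rewrite gee0_abs ?lee_fin ?C_ge0 ?addr_ge0//.
  by [].
apply: integral_ge0 => w _; rewrite lee_fin C_ge0//.
exact: reflected_ge0.
Qed.

Lemma cvg_mean_cost u x : 0 < u -> 0 <= x ->
  fine (F x u (Num.max 0 t)) @[t --> +oo] --> G u.
Proof.
move=> u0 x0; apply/cvg_pinftyP => v voo.
have m0 n : 0 <= Num.max 0 (v n) by rewrite le_max lexx.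
pose f_ n w := (pos_ext C (forward_content x u (Num.max 0 (v n)) (fun s => W s w)))%:E.
have mG : measurable_fun setT (fun w => (C (fine (Z u w)))%:E).
  by have /integrableP[] := integrable_stationary u0.
have cf : {ae P, forall w, setT w -> f_ ^~ w @ \oo --> (C (fine (Z u w)))%:E}.
  apply: filterS ae_max_workload_fin_num => w fz _.
  have u20 : 0 < u / 2 by rewrite divr_gt0.
  have u2u : u / 2 < u by rewrite ltr_pdivrMr// ltr_pMr// ltr1n.
  have c1 := cvg_forward_content (W0 w) (@cW w) x u2u (fz _ u20).
  have c2 : forward_content x u (Num.max 0 t) (fun s => W s w) @[t --> +oo] -->
      fine (Z u w).
    apply: cvg_trans c1; apply: near_eq_cvg; near=> t.
    rewrite max_r//; near: t; apply: nbhs_pinfty_ge; exact: num_real.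
  have c3 := (cvg_comp _ _ voo c2).
  rewrite /f_; apply: cvg_EFin; first exact: nearW.
  rewrite -(pos_extE C (zge0 u w)).
  have cC : {for fine (Z u w), continuous (pos_ext C)} by exact: continuous_pos_path.
  exact: (continuous_cvg _ cC c3).
have bf : {ae P, forall w n, setT w -> (`|f_ n w| <= (C (x + fine (Z u w)))%:E)%E}.
  have negl n : P.-negligible
      (~` [set w | pos_ext C (forward_content x u (Num.max 0 (v n)) (fun s => W s w)) <=
                   C (x + fine (Z u w))]).
    exact: (ae_forward_cost_le u0 x0 (m0 n)).
  apply: negligibleS (negligible_bigcup negl) => w /= nall.
  apply: contrapT => nbig; apply: nall => n _.
  rewrite /f_ lee_fin ger0_norm ?pos_ext_ge0//.
  by apply: contrapT => nle; apply: nbig; exists n.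
have [_ _ c] := dominated_convergence measurableT
  (fun n => measurable_forward_cost x u (m0 n)) mG cf (integrable_cost u0 x0) bf.
apply: fine_cvg; rewrite stationary_cost_integral//.
move: c; apply: cvg_trans; apply: near_eq_cvg; near=> n.
by rewrite /= mean_costE.
Unshelve. all: by end_near. Qed.

(** * Exchanging expectation and time integral *)

(** Boundedness over a bounded time makes the inner integral finite, and so equal
    to the extended-real one that Tonelli's theorem deals with. *)
Lemma reflected_bounded x u T w : 0 < u -> exists2 M, 0 <= M &
  forall t, t \in `[0, T] -> C (reflected x u (fun s => W s w) t) <= M.
Proof.
move=> u0; have [T0|T0] := ltP T 0.
  exists 0 => // t; rewrite in_itv/= => /andP[t0 /(le_trans t0)].
  by rewrite leNgt T0.
pose a t := `|W (Num.max 0 t) w|.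
have ca : {within `[0, T], continuous a}.
  apply: continuous_subspaceT => t.
  apply: cvg_norm.
  exact: (@continuous_pos_path _ (fun t => W t w) (@cW w) t).
have [c _ cmax] := EVT_max T0 ca.
have aB s : s \in `[0, T] -> `|W s w| <= a c.
  move=> sT; have := cmax s sT; rewrite /a max_r//.
  by move: sT; rewrite in_itv => /andP[].
have a0 : 0 <= a c by exact: normr_ge0.
exists (C (`|x| + 2 * a c)).
  by rewrite C_ge0// addr_ge0// mulr_ge0.
move=> t tT; have /andP[t0 tT'] : 0 <= t <= T by move: tT; rewrite in_itv.
have r0 := reflected_ge0 x u t0 (@cW w).
apply: C_nondecr; first by rewrite in_itv/= andbT.
  by rewrite in_itv/= andbT addr_ge0// mulr_ge0.
apply/(reflected_leP x u t0 (@cW w)); split.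
  have := ler_norm x; have := aB t tT; rewrite ler_norml => /andP[_].
  have := mulr_ge0 (ltW u0) t0; lra.
move=> k; have /andP[q0 q1] := @unit_rat_itv R k.
have tq0 : 0 <= t * unit_rat k by rewrite mulr_ge0.
have tqt : t * unit_rat k <= t by rewrite ler_piMr.
have qT : t * unit_rat k \in `[0, T] by rewrite in_itv/= tq0 (le_trans tqt).
have := aB _ tT; have := aB _ qT; rewrite !ler_norml => /andP[h1 h2] /andP[h3 h4].
have : 0 <= u * (t - t * unit_rat k) by apply: mulr_ge0; [exact: ltW|rewrite subr_ge0].
have := normr_ge0 x; lra.
Qed.

Let joint x u (z : Omega * measurableTypeR R) :=
  pos_ext C (reflected x u (fun s => W s z.1) (Num.max 0 z.2)).

Let measurable_joint x u : measurable_fun setT (joint x u).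
Proof.
by apply: (measurable_pos_ext C_cont); exact: measurable_reflected_joint.
Qed.

Lemma expected_cost x u T : 0 < u ->
  ('E_P[fun w => (\int[mu]_(t in `[0%R, T]) C (reflected x u (fun s => W s w) t))%R] =
   \int[mu]_(t in `[0%R, T]) F x u (Num.max 0 t)%R)%E.
Proof.
move=> u0; rewrite unlock.
have patch w t : ((fun t => (C (reflected x u (fun s => W s w) t))%:E) \_ `[0%R, T]) t =
    (joint x u (w, t) * \1_(`[0%R, T]%classic) t)%:E.
  rewrite patchE indicE; case: ifPn => tT; last by rewrite mulr0.
  move: tT; rewrite inE/= in_itv/= => /andP[t0 _].
  by rewrite mulr1 /joint/= max_r// pos_extE//; exact: reflected_ge0.
have mjoint : measurable_fun setT (fun z : Omega * measurableTypeR R =>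
    (joint x u z * \1_(`[0%R, T]%classic) z.2)%:E).
  apply/measurable_EFinP; apply: measurable_funM; first exact: measurable_joint.
  apply: (measurableT_comp (f := (\1_(`[0%R, T]%classic) : measurableTypeR R -> R))) => //.
have joint0 (z : Omega * measurableTypeR R) :
    (0 <= (joint x u z * \1_(`[0%R, T]%classic) z.2)%:E)%E.
  by rewrite lee_fin mulr_ge0// pos_ext_ge0.
transitivity (\int[P]_w \int[mu]_t (joint x u (w, t) * \1_(`[0%R, T]%classic) t)%:E)%E.
  apply: eq_integral => w _.
  under [RHS]eq_integral do rewrite -patch.
  rewrite -integral_mkcond /Rintegral fineK//.
  have [M M0 CM] := reflected_bounded x T w u0.
  rewrite ge0_fin_numE; last first.
    apply: integral_ge0 => t /=; rewrite in_itv/= => /andP[t0 _].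
    by rewrite lee_fin C_ge0//; exact: reflected_ge0.
  apply: (@le_lt_trans _ _ (\int[mu]_(t in `[0%R, T]) M%:E)%E).
    apply: ge0_le_integral => //.
    - move=> t /=; rewrite in_itv/= => /andP[t0 _].
      by rewrite lee_fin C_ge0//; exact: reflected_ge0.
    - have mw : measurable_fun setT (fun t : measurableTypeR R => joint x u (w, t)).
        exact: (measurableT_comp (measurable_joint x u) (pair1_measurable w)).
      apply/measurable_EFinP; apply: eq_measurable_fun (measurable_funTS mw) => t.
      rewrite inE/= in_itv/= => /andP[t0 _].
      by rewrite /joint/= max_r// pos_extE//; exact: reflected_ge0.
  rewrite integral_cst//= lebesgue_measure_itv/=.
  by case: ifPn => _; rewrite ?mule0// -EFinB -EFinM ltry.
transitivity (\int[mu]_t \int[P]_w (joint x u (w, t) * \1_(`[0%R, T]%classic) t)%:E)%E.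
  exact: (@fubini_tonelli _ _ _ _ _ P (@lebesgue_measure R) _ mjoint joint0).
rewrite [RHS]integral_mkcond; apply: eq_integral => t _.
rewrite patchE; case: ifPn => tT.
  apply: eq_integral => w _.
  rewrite indicE tT mulr1 /joint/= pos_extE//; apply: reflected_ge0 => //.
  by rewrite le_max lexx.
apply: integral0_eq => w _.
by rewrite indicE (negbTE tT) mulr0.
Qed.

Lemma average_costE p (h : R -> R) u x : 0 < u -> 0 <= x ->
  average_cost P W p h C u x = (h u + p * u + G u)%:E.
Proof.
move=> u0 x0; rewrite /average_cost [RHS]EFinD; congr (_ + _)%E.
have m0 t : 0 <= Num.max 0 t :> R by rewrite le_max lexx.
pose f t := fine (F x u (Num.max 0 t)).
have fE t : F x u (Num.max 0 t) = (f t)%:E by rewrite fineK// mean_cost_fin_num.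
under eq_fun => T do rewrite expected_cost//.
under eq_fun => T do under eq_integral do rewrite fE.
have fI := integrable_fin_num measurableT (integrable_cost u0 x0).
apply: (cesaro_limf_esup (M := fine (\int[P]_w (C (x + fine (Z u w)))%:E))).
- have mF : measurable_fun setT (fun t : measurableTypeR R => F x u (Num.max 0 t)).
    have mj : measurable_fun setT (EFin \o joint x u).
      by apply/measurable_EFinP; exact: measurable_joint.
    have j0 z : (0 <= (EFin \o joint x u) z)%E by rewrite lee_fin pos_ext_ge0.
    apply: (eq_measurable_fun (fubini_G P (EFin \o joint x u))); last first.
      exact: measurable_fun_fubini_tonelli_G.
    move=> t _; rewrite /fubini_G /F.
    apply: eq_integral => w _; rewrite /joint/= pos_extE//.
    exact: reflected_ge0.
  exact: (measurableT_comp (fine_measurable measurableT)).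
- move=> t; rewrite fine_ge0/=; last first.
    apply: integral_ge0 => w _; rewrite lee_fin C_ge0//.
    exact: reflected_ge0.
  by rewrite -lee_fin -fE fineK// mean_cost_le.
- exact: cvg_mean_cost.
Qed.

(** * The stationary cost as a function of the drift *)

(** Paths give continuity in the rate; for rates near [u], the cost at rate [u / 2]
    dominates. *)
Lemma continuous_stationary_cost u : 0 < u -> {for u, continuous G}.
Proof.
move=> u0; have u20 : 0 < u / 2 by rewrite divr_gt0.
have u2u : u / 2 < u by rewrite ltr_pdivrMr// ltr_pMr// ltr1n.
have I0 v : `](u / 2), (2 * u)[%classic v -> 0 < v /\ u / 2 < v.
  by rewrite /= in_itv/= => /andP[h _]; split => //; exact: lt_trans h.
apply: (@continuity_under_integral R d Omega P (fun v w => C (fine (Z v w))) setT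
  measurableT (u / 2) (2 * u) _ _ (fun w => C (fine (Z (u / 2) w)))).
- by move=> v /I0[v0 _]; exact: integrable_stationary.
- apply: filterS ae_max_workload_fin_num => w fz _ v /set_mem /I0[_ uv].
  rewrite (_ : (fun v => C _) = pos_ext C \o (fun v => fine (Z v w))); last first.
    by apply/funext => t /=; rewrite pos_extE.
  apply: continuous_comp; last exact: continuous_pos_path.
  exact: (fine_workload_continuous (W0 w) uv (fz _ u20)).
- exact: integrable_stationary.
- move=> v /I0[v0 uv]; apply: filterS ae_max_workload_fin_num => w fz _.
  rewrite ger0_norm ?C_ge0//; apply: C_nondecr; rewrite ?in_itv/= ?zge0//.
  exact: fine_workload_nincr (W0 w) _ _ (ltW uv) (fz _ u20).
- by rewrite inE/= in_itv/= u2u/= ltr_pMl// ltr1n.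
Qed.

Lemma stationary_cost_ge0 u : 0 <= G u.
Proof.
by apply: fine_ge0; apply: integral_ge0 => w _; rewrite lee_fin C_ge0.
Qed.

(** Fix a level [c] with [4 * A <= C c], then a time [s] at which the variance of
    [W] is so large that [W s > 2 * c] with probability at least [1/4]. For small
    rates [u * s <= c], and then the workload exceeds [c] on this event. *)
Lemma stationary_cost_cvg0 : C y @[y --> +oo] --> +oo -> G u @[u --> 0^'+] --> +oo.
Proof.
move=> /cvgryPge Coo; apply/cvgryPge => A.
have [c [c0 cA]] : exists c, 0 < c /\ 4 * A <= C c.
  apply: (@filter_ex _ (+oo_R)); apply: filterI; last exact: Coo.
  by apply: nbhs_pinfty_gt; exact: num_real.
pose s := 16 * (2 * c) ^+ 2 * normal_moment R 1 + 2.
have k0 : 0 <= 16 * (2 * c) ^+ 2 * normal_moment R 1.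
  by rewrite mulr_ge0 ?normal_moment_ge0// mulr_ge0// exprn_ge0// mulr_ge0// ltW.
have s0 : 0 < s by rewrite /s; lra.
(* [s `^ (2 * H) >= s] because [s >= 1] and [2 * H >= 1] *)
have var : 16 * (2 * c) ^+ 2 * normal_moment R 1 < s `^ (2 * H).
  apply: (@lt_le_trans _ _ s); first by rewrite /s; lra.
  rewrite -{1}[s]powRr1; last exact: ltW.
  apply: ler_powR; first by rewrite /s; lra.
  by have := H_ge; lra.
have gN : centred_gaussian P (fun w => - W s w) (s `^ (2 * H)).
  have := @fbm_lincomb_gaussian _ _ _ _ _ _ W_fBm 1 (fun=> s) (fun=> -1) (fun=> ltW s0).
  rewrite !big_ord1 mulrNN !mulr1 mul1r fbm_covxx//.
  congr (centred_gaussian P _ _); apply/funext => w.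
  by rewrite big_ord1 mulN1r.
have c20 : 0 <= 2 * c by rewrite mulr_ge0// ltW.
have tail := gaussian_tail c20 (fbm_gaussian H_gt0 W_fBm (ltW s0)) gN var.
pose E := [set w | 2 * c < W s w].
have mE : measurable E.
  by rewrite -[X in measurable X]setTI; exact: measurable_fun_ltr.
near=> u.
have u0 : 0 < u by near: u; exact: nbhs_right_gt.
have us : u * s <= c.
  rewrite -ler_pdivlMr//; near: u; apply: nbhs_right_le.
  by rewrite divr_gt0.
rewrite -lee_fin stationary_cost_integral//.
apply: (@le_trans _ _ (\int[P]_w ((C c)%:E * (\1_E w)%:E))%E).
  rewrite ge0_integralZl//; last 2 first.
  - by apply/measurable_EFinP; exact: measurable_indic.
  - by rewrite lee_fin C_ge0// ltW.
  rewrite integral_indic// setIT.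
  apply: (@le_trans _ _ ((C c)%:E * (4^-1)%:E)%E).
    by rewrite -EFinM lee_fin ler_pdivlMr// mulrC.
  by rewrite lee_wpmul2l// lee_fin C_ge0// ltW.
apply: ae_ge0_le_integral => //.
- by move=> w _; rewrite -EFinM lee_fin mulr_ge0// C_ge0// ltW.
- by apply: measurable_funeM; apply/measurable_EFinP; exact: measurable_indic.
- by move=> w _; rewrite lee_fin C_ge0.
- by have /integrableP[] := integrable_stationary u0.
apply: filterS ae_max_workload_fin_num => w fz _.
rewrite -EFinM lee_fin indicE; have [wE|_] := boolP (w \in E); last by rewrite mulr0 C_ge0.
rewrite mulr1; apply: C_nondecr.
- by rewrite in_itv/= andbT ltW.
- by rewrite in_itv/= andbT zge0.
have := le_fine_workload (fz _ u0) (ltW s0).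
by move: wE; rewrite inE /E/=; move: us; rewrite /Z; lra.
Unshelve. all: by end_near. Qed.

Lemma stationary_cost_convex a b t : 0 < a -> 0 < b -> 0 <= t <= 1 ->
  (forall y z, 0 <= y -> 0 <= z -> C (t * y + (1 - t) * z) <= t * C y + (1 - t) * C z) ->
  G (t * a + (1 - t) * b) <= t * G a + (1 - t) * G b.
Proof.
move=> a0 b0 t01 Cc; have /andP[t0 t1] := t01.
have t1' : 0 <= 1 - t by rewrite subr_ge0.
have ab0 : 0 < t * a + (1 - t) * b.
  have [->|tn] := eqVneq t 0; first by rewrite mul0r add0r subr0 mul1r.
  by rewrite ltr_wpDr ?mulr_ge0 ?mulr_gt0// ?ltW// lt_neqAle eq_sym tn.
have mC u : 0 < u -> measurable_fun setT (fun w => (C (fine (Z u w)))%:E).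
  by move=> u0; have /integrableP[] := integrable_stationary u0.
have C0 u w : (0 <= (C (fine (Z u w)))%:E)%E by rewrite lee_fin C_ge0.
rewrite -lee_fin EFinD !EFinM !stationary_cost_integral//.
rewrite -!ge0_integralZl//; [|exact: mC..].
rewrite -ge0_integralD//; last 4 first.
- by move=> w _; rewrite mule_ge0.
- by apply: measurable_funeM; exact: mC.
- by move=> w _; rewrite mule_ge0.
- by apply: measurable_funeM; exact: mC.
apply: ae_ge0_le_integral => //.
- exact: mC.
- by move=> w _; rewrite adde_ge0// mule_ge0.
- by apply: emeasurable_funD; apply: measurable_funeM; exact: mC.
apply: filterS ae_max_workload_fin_num => w fz _.
rewrite -!EFinM -EFinD lee_fin; apply: le_trans (Cc _ _ (zge0 a w) (zge0 b w)).
apply: C_nondecr; rewrite ?in_itv/= ?andbT ?zge0//.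
  by rewrite addr_ge0 ?mulr_ge0.
exact: fine_workload_convex (W0 w) _ _ _ t01 (fz _ a0) (fz _ b0).
Qed.

End stationary.

Theorem theorem3p4 (R : realType) (d : measure_display)
    (Omega : measurableType d) (P : probability Omega R)
    (H : R) (W : R -> {RV P >-> R}) (p : R) (h C : R -> R) (K gamma : R)
    (H_ge : 2^-1 <= H) (H_lt : H < 1) (W_fBm : is_fBm P H W)
    (p_ge0 : 0 <= p)
    (h_ge0 : forall u, 0 <= u -> 0 <= h u)
    (h_cont : {within `[0, +oo[, continuous h})
    (h_nondecr : {in `[0, +oo[ &, {homo h : u v / u <= v}})
    (h_lim : h u @[u --> +oo] --> +oo)
    (C_ge0 : forall y, 0 <= y -> 0 <= C y)
    (C_cont : {within `[0, +oo[, continuous C})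
    (C_nondecr : {in `[0, +oo[ &, {homo C : y z / y <= z}})
    (K_gt0 : 0 < K) (gamma_gt0 : 0 < gamma)
    (C_growth : forall y, 0 <= y -> C y <= K * (1 + y `^ gamma)) :
  (* a real-valued I, so that its first property includes finiteness *)
  exists I : R -> R,
    [/\ (* (i) *)
        [/\ forall u x, 0 < u -> 0 <= x ->
              average_cost P W p h C u x = (I u)%:E,
            forall u, 0 < u ->
              (I u)%:E = ((h u + p * u)%:E + stationary_cost P W C u)%E
          & {in `]0, +oo[, continuous I}],
        (* (ii); the limit at 0 fails for every bounded C *)
        (C y @[y --> +oo] --> +oo -> I u @[u --> 0^'+] --> +oo) /\
        (I u @[u --> +oo] --> +oo)
      & (* (iii) *)
        convex_function (`[0, +oo[%classic : set R) h ->
        convex_function (`[0, +oo[%classic : set R) C ->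
        convex_function (`]0, +oo[%classic : set R) I].
Proof.
pose G u := \int[P]_w C (fine (max_workload u (fun s => W s w))).
have G0 : forall u, 0 <= G u by move=> u; exact: stationary_cost_ge0 W_fBm C_ge0 u.
exists (fun u => h u + p * u + G u); split.
- split.
  + move=> u x u0 x0.
    exact: (average_costE H_ge H_lt W_fBm C_ge0 C_cont C_nondecr K_gt0 gamma_gt0 C_growth p h u0 x0).
  + move=> u u0; by rewrite (stationary_costE H_ge H_lt W_fBm C_ge0 C_cont K_gt0 gamma_gt0 C_growth u0) -EFinD.
  + move=> u; rewrite in_itv/= andbT => u0.
    have [hc _] := (continuous_within_itvcyP _ _).1 h_cont.
    apply: cvgD; last exact: (continuous_stationary_cost H_ge H_lt W_fBm C_ge0 C_cont C_nondecr K_gt0 gamma_gt0 C_growth u0).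
    apply: cvgD; last by apply: cvgM; [exact: cvg_cst|exact: cvg_id].
    by apply: hc; rewrite in_itv/= andbT.
- split.
  + move=> Coo; apply: ger_cvgy (stationary_cost_cvg0 H_ge H_lt W_fBm C_ge0 C_cont C_nondecr K_gt0 gamma_gt0 C_growth Coo).
    near=> u; have u0 : 0 < u by near: u; exact: nbhs_right_gt.
    by rewrite lerDr addr_ge0 ?h_ge0 ?mulr_ge0// ltW.
  + apply: ger_cvgy h_lim.
    near=> u; have u0 : 0 <= u by near: u; apply: nbhs_pinfty_ge; exact: num_real.
    by rewrite -addrA lerDl addr_ge0// mulr_ge0.
- move=> hcvx Ccvx t a b; rewrite !inE/= !in_itv/= !andbT => a0 b0.
  have t01 : 0 <= t%:num <= (1 : R) by apply/andP; split.
  have cvxE (f : R -> R) : convex_function (`[0, +oo[%classic : set R) f ->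
      forall y z, 0 <= y -> 0 <= z ->
      f (t%:num * y + (1 - t%:num) * z) <= t%:num * f y + (1 - t%:num) * f z.
    move=> fc y z y0 z0.
    by have := fc t y z; rewrite !inE/= !in_itv/= !andbT; apply.
  have hab := cvxE h hcvx a b (ltW a0) (ltW b0).
  have Gab : G (t%:num * a + (1 - t%:num) * b) <= t%:num * G a + (1 - t%:num) * G b :=
    stationary_cost_convex H_ge H_lt W_fBm C_ge0 C_cont C_nondecr
    K_gt0 gamma_gt0 C_growth a0 b0 t01 (cvxE C Ccvx).
  rewrite -[leLHS]/(h (t%:num * a + (1 - t%:num) * b) + p * (t%:num * a + (1 - t%:num) * b) +
     G (t%:num * a + (1 - t%:num) * b)).
  rewrite -[leRHS]/(t%:num * (h a + p * a + G a) + (1 - t%:num) * (h b + p * b + G b)).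
  apply: le_trans (lerD (lerD hab (lexx _)) Gab) _.
  rewrite le_eqVlt; apply/orP; left; apply/eqP; ring.
Unshelve. all: by end_near. Qed.
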